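(* Let $N$ be an odd positive integer and $\alpha,\beta>0$ with $\alpha\beta^{N}=\pi^{N+1}$. Then for every positive integer $m$, \begin{align*} &\alpha^{-\frac{2Nm}{N+1}}\sum_{n=1}^{\infty}\frac{n^{-2Nm-1}\exp\left(-\tfrac{1}{2}(2n)^{N}\alpha\right)}{1-\exp\left(-(2n)^{N}\alpha\right)}\\ &=\left(-\beta^{\frac{2N}{N+1}}\right)^{-m}\frac{2^{2m(N-1)}}{N}\bigg[\frac{(2^{-2m}-1)}{2}\zeta(2m+1)+(-1)^{\frac{N+3}{2}}\sum_{j=-\frac{N-1}{2}}^{\frac{N-1}{2}}(-1)^{j}\sum_{n=1}^{\infty}\frac{(-1)^nn^{-2m-1}}{\exp\left((2n)^{\frac{1}{N}}\beta e^{\frac{i\pi j}{N}}\right)-1}\bigg]\\ &\quad+(-1)^{m+\frac{N+3}{2}}2^{2Nm}\sum_{j=0}^{\left\lfloor\frac{N+1}{2N}+m\right\rfloor}\frac{(-1)^j(2^{1-2j}-1)B_{2j}B_{N+1+2N(m-j)}}{(2j)!(N+1+2N(m-j))!}\alpha^{\frac{2j}{N+1}}\beta^{N+\frac{2N^2(m-j)}{N+1}}. \end{align*}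
   Context: $\zeta$ is the Riemann zeta function and $B_j$ are the Bernoulli numbers ($\sum_{j\ge0}B_jz^j/j!=z/(e^z-1)$, with $B_1=\tfrac12$ convention given by $B_j=B_j(1)$ where $\sum B_j(a)z^j/j!=ze^{az}/(e^z-1)$). Sums over $j$ run through integers. *)

(* Defs.v *)
From Stdlib Require Import Reals Lra Lia ZArith.
From Coquelicot Require Import Coquelicot.
Open Scope R_scope.

(* Bernoulli numbers with the convention B_1 = +1/2 (B_j = B_j(1)),
   i.e. sum_j B_j z^j / j! = z e^z / (e^z - 1).  Equivalently (comparing
   coefficients of z e^z = (e^z - 1) * sum_j B_j z^j/j!), B_0 = 1 and
   sum_{k=0}^{n} C(n+1,k) B_k = n+1 for n >= 1.  [bern_table n] tabulates
   B_0 .. B_n. *)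
Fixpoint bern_table (n : nat) : nat -> R :=
  match n with
  | O => fun _ => 1
  | S n' =>
      let t := bern_table n' in
      fun k => if (k <=? n')%nat then t k
               else (INR (S n) - sum_f_R0 (fun i => Binomial.C (S (S n')) i * t i) n')
                    / INR (S (S n'))
  end.

Definition bernoulli (n : nat) : R := bern_table n n.

Definition zeta_nat (s : nat) : R := Series (fun n => / (INR (S n)) ^ s).

Definition Cexp (z : C) : C := (exp (fst z) * cos (snd z), exp (fst z) * sin (snd z)).

Definition CSeries (a : nat -> C) : C :=
  (Series (fun n => fst (a n)), Series (fun n => snd (a n))).

(* Main.v *)
(* Both sides are lattice sums over pairs [(l, k)] of positive integers.  Put [Q_l = tau l^N] with
   [tau = (2 pi)^N / (2 beta^N)].  Expanding [1 / sinh] and [coth] in partial fractions (and, for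
   [coth], summing over the [N]-th roots of unity) turns the two infinite sums into
   [sum (-1)^k (Q_l / l) Q_l^(-2m) / (Q_l^2 + k^2)] and
   [sum (-1)^k (Q_l / l) k^(-2m) / (Q_l^2 + k^2)], up to zeta values.  Since
   [1 / (Q^2 k^2) = (1 / Q^2 + 1 / k^2) / (Q^2 + k^2)], one passes from the first to the second by
   moving one factor at a time from [Q_l^(-2)] to [k^(-2)], each step costing a sign and a product of
   two even zeta values, which Euler's formula writes with Bernoulli numbers.

   The partial fractions of [coth] at a complex argument come from iterating
   [coth z = (coth (z / 2) + coth ((z + i pi) / 2)) / 2] and passing to the limit termwise. *)

Require Import Defs.
From Stdlib Require Import Reals ZArith Lra Lia Psatz.
From Coquelicot Require Import Coquelicot.
Open Scope R_scope.

(** * Series *)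

(** On the left of the theorem the summation index is [l], and the partial fractions of [1 / sinh]
    supply [k]; on the right the index is [k], and those of [coth] supply [l]. The two double sums
    thus arise in opposite orders, and exchanging them rests on a bound of the terms by a constant
    times [1 / (l^2 k^2)].

    The value of [tau] is forced from both sides: the relation between [alpha] and [beta] gives
    [(2 l)^N alpha = 2 pi Q_l], and for [w = (2 k)^(1/N) beta] one has [w^(2 N) + (2 pi l)^(2 N) = 4
    beta^(2 N) (Q_l^2 + k^2)].

    The value [zeta (2 m + 1)] stems from the constant in [1 / (e^z - 1) = (coth (z / 2) - 1) / 2].
    The polar parts [2 / z] of [coth (z / 2)] cancel over the roots of unity unless [N = 1]; this is
    also the only case where the Bernoulli sum runs past [j = m], and the two exceptions compensate
    each other. *)

Lemma ex_series_dom (a b : nat -> R) :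
  (forall n, Rabs (a n) <= b n) -> ex_series b -> ex_series a.
Proof.
  intros H Hb. exact (ex_series_le (K := R_AbsRing) (V := R_CompleteNormedModule) a b H Hb).
Qed.

Lemma Series_dom (a b : nat -> R) :
  (forall n, Rabs (a n) <= b n) -> ex_series b -> Rabs (Series a) <= Series b.
Proof.
  intros H Hb.
  assert (Ha : ex_series (fun n => Rabs (a n))).
  { apply ex_series_dom with b; auto. intros n. now rewrite Rabs_Rabsolu. }
  eapply Rle_trans. apply Series_Rabs, Ha.
  apply Series_le; auto. intros n; split; auto. apply Rabs_pos.
Qed.

Lemma ex_series_ext_R (a b : nat -> R) :
  (forall n, a n = b n) -> ex_series a -> ex_series b.
Proof. intros H. apply ex_series_ext, H. Qed.

Lemma ex_series_plus_R (a b : nat -> R) :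
  ex_series a -> ex_series b -> ex_series (fun n => a n + b n).
Proof. intros Ha Hb. exact (ex_series_plus (K := R_AbsRing) (V := R_NormedModule) a b Ha Hb). Qed.

Lemma ex_series_scal_R (c : R) (a : nat -> R) :
  ex_series a -> ex_series (fun n => c * a n).
Proof. intros Ha. exact (ex_series_scal (K := R_AbsRing) (V := R_NormedModule) c a Ha). Qed.

Lemma is_lim_seq_sum_f_R0 (f : nat -> nat -> R) (g : nat -> R) (K : nat) :
  (forall k, is_lim_seq (fun p => f p k) (g k)) ->
  is_lim_seq (fun p => sum_f_R0 (f p) K) (sum_f_R0 g K).
Proof.
  intros H. induction K; simpl; auto.
  apply is_lim_seq_plus'; auto.
Qed.

Lemma Series_tail_lim (a : nat -> R) :
  ex_series a -> is_lim_seq (fun n => Series (fun k => a (S n + k)%nat)) 0.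
Proof.
  intros Ha.
  apply is_lim_seq_ext with (fun n => Series a - sum_f_R0 a n).
  - intros n. rewrite (Series_incr_n a (S n)); auto with arith. simpl. ring.
  - replace 0 with (Series a - Series a) by ring.
    apply is_lim_seq_minus'. apply is_lim_seq_const.
    apply is_lim_seq_ext with (sum_n a). intros n; apply sum_n_Reals.
    apply (Series_correct a Ha).
Qed.

(* Tannery's theorem. *)
Lemma Series_dominated_lim (f : nat -> nat -> R) (g M : nat -> R) (K0 : nat) :
  (forall k, is_lim_seq (fun p => f p k) (g k)) ->
  eventually (fun p => forall k, (K0 <= k)%nat -> Rabs (f p k) <= M k) ->
  ex_series M ->
  ex_series g /\ is_lim_seq (fun p => Series (f p)) (Series g).
Proof.
  intros Hlim [P0 Hdom] HM.
  assert (HgM : forall k, (K0 <= k)%nat -> Rabs (g k) <= M k).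
  { intros k Hk.
    assert (Hl : is_lim_seq (fun p => Rabs (f p k)) (Rabs (g k))).
    { apply (is_lim_seq_abs _ (Finite (g k))), Hlim. }
    apply (is_lim_seq_le_loc (fun p => Rabs (f p k)) (fun _ => M k) (Rabs (g k)) (M k)); auto.
    - exists P0. intros p Hp; auto.
    - apply is_lim_seq_const. }
  assert (Hex : forall h : nat -> R, (forall k, (K0 <= k)%nat -> Rabs (h k) <= M k) -> ex_series h).
  { intros h Hh. apply (ex_series_incr_n h K0).
    apply ex_series_dom with (fun k => M (K0 + k)%nat).
    intros n; apply Hh; lia. now apply (ex_series_incr_n M K0). }
  split; [now apply Hex|].
  assert (T := Series_tail_lim M HM).
  apply is_lim_seq_spec in T.
  apply is_lim_seq_spec. intros eps.
  assert (He : 0 < eps / 3) by (destruct eps; simpl; lra).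
  destruct (T (mkposreal _ He)) as [K1 HK1]. simpl in HK1.
  (* Past [K] both tails are dominated by that of [M], which is below [eps / 3]; the finitely many
     terms up to [K] converge one by one, so no bound on them is required. *)
  set (K := max K0 K1).
  assert (HK := HK1 K (Nat.le_max_r _ _)).
  assert (Hs := is_lim_seq_sum_f_R0 f g K Hlim).
  apply is_lim_seq_spec in Hs. destruct (Hs (mkposreal _ He)) as [P1 HP1]. simpl in HP1.
  exists (max P0 P1). intros p Hp.
  assert (H1 := HP1 p ltac:(lia)).
  assert (Hd := Hdom p ltac:(lia)).
  rewrite (Series_incr_n (f p) (S K)), (Series_incr_n g (S K)); auto with arith.
  change (Nat.pred (S K)) with K.
  assert (HexM : ex_series (fun k => M (S K + k)%nat)) by now apply (ex_series_incr_n M (S K)).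
  assert (Ha := Series_dom (fun k => f p (S K + k)%nat) (fun k => M (S K + k)%nat)
     (fun n => Hd (S K + n)%nat ltac:(lia)) HexM).
  assert (Hb := Series_dom (fun k => g (S K + k)%nat) (fun k => M (S K + k)%nat)
     (fun n => HgM (S K + n)%nat ltac:(lia)) HexM).
  rewrite Rminus_0_r in HK. change (Rabs (Series (fun k => M (S K + k)%nat)) < eps / 3) in HK.
  assert (HK2 := Rle_abs (Series (fun k => M (S K + k)%nat))).
  revert H1 Ha Hb HK HK2.
  generalize (Series (fun k => f p (S K + k)%nat)) (Series (fun k => g (S K + k)%nat))
     (Series (fun k => M (S K + k)%nat)) (sum_f_R0 (f p) K) (sum_f_R0 g K).
  intros a b c d e H1 Ha Hb Hc Hc2.
  apply Rabs_def2 in H1. apply Rabs_le_between in Ha. apply Rabs_le_between in Hb.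
  apply Rabs_def1; lra.
Qed.

Lemma Series_sum_f_R0 (f : nat -> nat -> R) (K : nat) :
  (forall i, ex_series (f i)) ->
  ex_series (fun j => sum_f_R0 (fun i => f i j) K) /\
  Series (fun j => sum_f_R0 (fun i => f i j) K) = sum_f_R0 (fun i => Series (f i)) K.
Proof.
  intros H. induction K; simpl; auto.
  destruct IHK as [E1 E2]. split.
  - now apply ex_series_plus_R.
  - rewrite Series_plus; auto. now rewrite E2.
Qed.

Lemma sum_f_R0_le_Series (a : nat -> R) (K : nat) :
  (forall n, 0 <= a n) -> ex_series a -> sum_f_R0 a K <= Series a.
Proof.
  intros H Ha. rewrite (Series_incr_n a (S K)); auto with arith. simpl Nat.pred.
  assert (0 <= Series (fun k => a (S K + k)%nat)); [|lra].
  rewrite <- (Rmult_0_l (Series (fun k => a (S K + k)%nat))), <- Series_scal_l.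
  apply Series_le. intros n. rewrite Rmult_0_l. split; auto with real.
  now apply (ex_series_incr_n a (S K)).
Qed.

(** Fubini from Tannery: the partial sums over [i], as functions of [j], converge termwise and are
    dominated by [Series a * b j]. Every double series below admits such a product bound. *)
Lemma Series_swap (f : nat -> nat -> R) (a b : nat -> R) :
  (forall i j, Rabs (f i j) <= a i * b j) -> ex_series a -> ex_series b ->
  (forall n, 0 <= a n) -> (forall n, 0 <= b n) ->
  ex_series (fun i => Series (fun j => f i j)) /\
  ex_series (fun j => Series (fun i => f i j)) /\
  Series (fun i => Series (fun j => f i j)) = Series (fun j => Series (fun i => f i j)).
Proof.
  intros Hf Ha Hb Pa Pb.
  assert (E1 : forall i, ex_series (fun j => f i j)).
  { intros i. apply ex_series_dom with (fun j => a i * b j); auto. now apply ex_series_scal_R. }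
  assert (E2 : forall j, ex_series (fun i => f i j)).
  { intros j. apply ex_series_dom with (fun i => b j * a i). intros n. now rewrite Rmult_comm.
    now apply ex_series_scal_R. }
  assert (X1 : ex_series (fun i => Series (fun j => f i j))).
  { apply ex_series_dom with (fun i => Series b * a i); [|now apply ex_series_scal_R].
    intros i. rewrite Rmult_comm, <- Series_scal_l. apply Series_dom; auto. now apply ex_series_scal_R. }
  destruct (Series_dominated_lim (fun p j => sum_f_R0 (fun i => f i j) p)
      (fun j => Series (fun i => f i j)) (fun j => Series a * b j) 0) as [X2 L].
  - intros j. apply is_lim_seq_ext with (sum_n (fun i => f i j)).
    intros n; apply sum_n_Reals. apply (Series_correct _ (E2 j)).
  - exists O. intros p _ j _.
    eapply Rle_trans. apply Rsum_abs.
    eapply Rle_trans. apply sum_Rle. intros i _. apply Hf.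
    rewrite <- scal_sum. rewrite Rmult_comm. apply Rmult_le_compat_r; auto.
    now apply sum_f_R0_le_Series.
  - now apply ex_series_scal_R.
  - split; auto. split; auto.
    assert (L2 : is_lim_seq (fun p => Series (fun j => sum_f_R0 (fun i => f i j) p))
                  (Series (fun i => Series (fun j => f i j)))).
    { apply is_lim_seq_ext with (sum_n (fun i => Series (fun j => f i j))).
      - intros p. rewrite sum_n_Reals. symmetry. now apply (Series_sum_f_R0 f p).
      - apply (Series_correct _ X1). }
    apply is_lim_seq_unique in L. apply is_lim_seq_unique in L2.
    rewrite L in L2. now injection L2.
Qed.

Lemma ex_series_inv_sq : ex_series (fun n => / INR (S n) ^ 2).
Proof.
  (* [1 / (n+1)^2 <= 2 / ((n+1) (n+2))], and the right side telescopes. *)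
  apply ex_series_dom with (fun n => 2 * (/ INR (S n) - / INR (S (S n)))).
  - intros n. rewrite !S_INR. assert (H := pos_INR n). set (x := INR n) in *.
    rewrite Rabs_pos_eq by (apply Rlt_le, Rinv_0_lt_compat; nra).
    replace (2 * (/ (x + 1) - / (x + 1 + 1))) with (/ ((x + 1) * (x + 2) / 2)) by (field; lra).
    apply Rinv_le_contravar; nra.
  - apply ex_series_scal_R. exists 1.
    assert (L : is_lim_seq (fun n => 1 - / INR (S (S n))) 1).
    { replace (Finite 1) with (Finite (1 - 0)) by (f_equal; ring). apply is_lim_seq_minus'. apply is_lim_seq_const.
      apply is_lim_seq_ext with (fun n => / INR (n + 2)).
      { intros n. now rewrite Nat.add_comm. }
      apply -> (is_lim_seq_incr_n (fun n => / INR n) 2).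
      replace (Finite 0) with (Rbar_inv p_infty) by reflexivity.
      apply is_lim_seq_inv. apply is_lim_seq_INR. discriminate. }
    refine (is_lim_seq_ext _ _ _ _ L).
    intros n. rewrite sum_n_Reals. induction n.
    + simpl. lra.
    + rewrite tech5, <- IHn. ring.
Qed.

Lemma INR_S_ge_1 (n : nat) : 1 <= INR (S n).
Proof. rewrite S_INR. assert (H := pos_INR n). lra. Qed.

Lemma INR_S_pos (n : nat) : 0 < INR (S n).
Proof. assert (H := INR_S_ge_1 n). lra. Qed.

Lemma inv_pow_le_inv_sq (s n : nat) : (2 <= s)%nat -> 0 < / INR (S n) ^ s <= / INR (S n) ^ 2.
Proof.
  intros Hs. assert (H := INR_S_ge_1 n). split.
  - apply Rinv_0_lt_compat, pow_lt. lra.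
  - apply Rinv_le_contravar. apply pow_lt; lra. now apply Rle_pow.
Qed.

Lemma ex_series_inv_pow (s : nat) : (2 <= s)%nat -> ex_series (fun n => / INR (S n) ^ s).
Proof.
  intros Hs. apply ex_series_dom with (2 := ex_series_inv_sq).
  intros n. destruct (inv_pow_le_inv_sq s n Hs). rewrite Rabs_pos_eq; lra.
Qed.

Lemma ex_series_alt (a : nat -> R) :
  ex_series (fun n => Rabs (a n)) -> ex_series (fun n => (-1) ^ S n * a n).
Proof.
  apply ex_series_dom. intros n. rewrite Rabs_mult, pow_1_abs. lra.
Qed.

(* With [k = n + 1]: the alternating sum is twice the sum over even [k], minus the full sum. *)
Lemma Series_alt (a : nat -> R) :
  ex_series (fun n => Rabs (a n)) -> ex_series (fun n => a (2 * n + 1)%nat) ->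
  Series (fun n => (-1) ^ S n * a n) = 2 * Series (fun n => a (2 * n + 1)%nat) - Series a.
Proof.
  intros Ha He.
  assert (L1 : is_lim_seq (sum_n (fun n => (-1) ^ S n * a n)) (Series (fun n => (-1) ^ S n * a n)))
    by exact (Series_correct _ (ex_series_alt a Ha)).
  assert (L2 : is_lim_seq (sum_n a) (Series a))
    by exact (Series_correct _ (ex_series_Rabs a Ha)).
  assert (L3 : is_lim_seq (sum_n (fun n => 2 * a (2 * n + 1)%nat)) (2 * Series (fun n => a (2 * n + 1)%nat))).
  { rewrite <- Series_scal_l. apply (Series_correct (fun n => 2 * a (2 * n + 1)%nat)).
    now apply ex_series_scal_R. }
  (* Cut after index [2 n + 1], the partial sums consist of whole pairs and the identity is already
     exact, so passing to this subsequence suffices. *)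
  assert (Hphi : filterlim (fun n => 2 * n + 1)%nat eventually eventually).
  { apply eventually_subseq. intros n. lia. }
  assert (M1 := is_lim_seq_subseq (sum_n (fun n => (-1) ^ S n * a n)) _ _ Hphi L1).
  assert (M2 := is_lim_seq_subseq (sum_n a) _ _ Hphi L2).
  assert (M3 := is_lim_seq_minus' _ _ _ _ L3 M2).
  assert (E : is_lim_seq (fun n => sum_n (fun n => (-1) ^ S n * a n) (2 * n + 1))
     (2 * Series (fun n => a (2 * n + 1)%nat) - Series a)).
  { refine (is_lim_seq_ext _ _ _ _ M3). intros n. rewrite !sum_n_Reals.
    induction n.
    - simpl. ring.
    - assert (P1 : (-1) ^ S (S (2 * n + 1)) = -1).
      { replace (S (S (2 * n + 1))) with (S (2 * S n)) by lia. apply pow_1_odd. }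
      assert (P2 : (-1) ^ S (S (S (2 * n + 1))) = 1).
      { replace (S (S (S (2 * n + 1)))) with (2 * S (S n))%nat by lia. apply pow_1_even. }
      replace (2 * S n + 1)%nat with (S (S (2 * n + 1))) by lia.
      rewrite !(tech5 _ (S (2 * n + 1))), !(tech5 _ (2 * n + 1)), (tech5 _ n), P1, P2, <- IHn.
      replace (2 * S n + 1)%nat with (S (S (2 * n + 1))) by lia. ring. }
  apply is_lim_seq_unique in E. apply is_lim_seq_unique in M1.
  rewrite E in M1. injection M1 as M1. symmetry. exact M1.
Qed.

(** * The complex hyperbolic cotangent *)

Lemma Cexp_add (z w : C) : Cexp (z + w) = (Cexp z * Cexp w)%C.
Proof.
  destruct z as [x y], w as [u v]. unfold Cexp, Cplus, Cmult; simpl.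
  rewrite exp_plus, cos_plus, sin_plus. f_equal; ring.
Qed.

Lemma Cexp_0 : Cexp 0 = 1%C.
Proof. unfold Cexp, RtoC; simpl. rewrite exp_0, cos_0, sin_0. f_equal; ring. Qed.

Lemma Cexp_mult_opp (z : C) : (Cexp z * Cexp (- z))%C = 1%C.
Proof. rewrite <- Cexp_add, <- Cexp_0. f_equal. ring. Qed.

Lemma Cexp_neq_0 (z : C) : Cexp z <> 0%C.
Proof.
  intros H. apply C1_nz. rewrite <- (Cexp_mult_opp z), H. ring.
Qed.

Lemma Cexp_opp (z : C) : Cexp (- z) = (/ Cexp z)%C.
Proof.
  assert (H := Cexp_neq_0 z). rewrite <- (Cmult_1_l (/ Cexp z)), <- (Cexp_mult_opp z). field. auto.
Qed.

Lemma Cmod_Cexp (z : C) : Cmod (Cexp z) = exp (fst z).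
Proof.
  unfold Cmod, Cexp; simpl fst; simpl snd.
  replace ((exp (fst z) * cos (snd z)) ^ 2 + (exp (fst z) * sin (snd z)) ^ 2)
    with (exp (fst z) ^ 2 * (Rsqr (sin (snd z)) + Rsqr (cos (snd z)))) by (unfold Rsqr; ring).
  rewrite sin2_cos2, Rmult_1_r. apply sqrt_pow2, Rlt_le, exp_pos.
Qed.

Lemma Cexp_neq_of_Cmod_1 (z c : C) : 0 < fst z -> Cmod c = 1 -> Cexp z <> c.
Proof.
  intros Hz Hc H. assert (E := Cmod_Cexp z). rewrite H, Hc in E.
  assert (F := exp_ineq1 (fst z) ltac:(lra)). lra.
Qed.

Lemma Cexp_sub_1_neq_0 (z : C) : 0 < fst z -> (Cexp z - 1)%C <> 0%C.
Proof.
  intros Hz H. apply (Cexp_neq_of_Cmod_1 z 1 Hz Cmod_1).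
  rewrite <- (Cplus_0_l 1), <- H. ring.
Qed.

Lemma Cexp_add_1_neq_0 (z : C) : 0 < fst z -> (Cexp z + 1)%C <> 0%C.
Proof.
  intros Hz H. apply (Cexp_neq_of_Cmod_1 z (- (1)) Hz Cmod_m1).
  rewrite <- (Cplus_0_l (- (1))), <- H. ring.
Qed.

Lemma Cexp_iPI : Cexp (0, PI) = (- (1))%C.
Proof.
  unfold Cexp, RtoC, Copp; simpl. rewrite exp_0, cos_PI, sin_PI. f_equal; ring.
Qed.

(* [coth (w / 2)]. *)
Definition coth2 (w : C) : C := ((Cexp w + 1) / (Cexp w - 1))%C.

(** With [e = Cexp (w / 2)], translation by [i pi] replaces [e] by [- e], and the mean of
    [(e + 1) / (e - 1)] and its reciprocal is [(e^2 + 1) / (e^2 - 1)]. *)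
Lemma coth2_double (w : C) : 0 < fst w ->
  coth2 w = (/ 2 * (coth2 (w / 2) + coth2 (w / 2 + (0, PI)%R)))%C.
Proof.
  intros Hw. unfold coth2.
  assert (Hh : 0 < fst (w / 2)%C) by (destruct w; simpl in *; nra).
  assert (H1 := Cexp_sub_1_neq_0 _ Hh). assert (H2 := Cexp_add_1_neq_0 _ Hh).
  assert (H3 := Cexp_sub_1_neq_0 _ Hw).
  rewrite (Cexp_add _ (0, PI)%R), Cexp_iPI.
  assert (E : Cexp w = (Cexp (w / 2) * Cexp (w / 2))%C).
  { rewrite <- Cexp_add. f_equal. field. }
  rewrite E in *. set (e := Cexp (w / 2)) in *.
  field. repeat split; auto.
  intros H. apply H2. transitivity (- 0)%C; [rewrite <- H|]; ring.
Qed.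

Fixpoint Csum (f : nat -> C) (n : nat) : C :=
  match n with O => 0%C | S k => (Csum f k + f k)%C end.

Lemma Csum_ext (f g : nat -> C) (n : nat) :
  (forall k, (k < n)%nat -> f k = g k) -> Csum f n = Csum g n.
Proof. induction n; simpl; intros H; auto. rewrite IHn, H; auto. Qed.

Lemma Csum_plus (f g : nat -> C) (n : nat) :
  Csum (fun k => (f k + g k)%C) n = (Csum f n + Csum g n)%C.
Proof. induction n; simpl. ring. rewrite IHn; ring. Qed.

Lemma Csum_scal (c : C) (f : nat -> C) (n : nat) :
  Csum (fun k => (c * f k)%C) n = (c * Csum f n)%C.
Proof. induction n; simpl. ring. rewrite IHn; ring. Qed.

Lemma Csum_add (f : nat -> C) (a b : nat) :
  Csum f (a + b) = (Csum f a + Csum (fun k => f (a + k)%nat) b)%C.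
Proof.
  induction b; simpl. rewrite Nat.add_0_r; ring.
  rewrite Nat.add_succ_r; simpl. rewrite IHb. ring.
Qed.

Lemma Csum_shift (f : nat -> C) (n : nat) :
  (f O + Csum (fun k => f (S k)) n)%C = (Csum f n + f n)%C.
Proof. induction n; simpl. ring. rewrite Cplus_assoc, IHn. ring. Qed.

Lemma Csum_rev (f : nat -> C) (n : nat) :
  Csum f n = Csum (fun k => f (n - 1 - k)%nat) n.
Proof.
  induction n; auto.
  change (Csum f (S n)) with (Csum f n + f n)%C.
  change (Csum (fun k => f (S n - 1 - k)%nat) (S n))
    with (Csum (fun k => f (S n - 1 - k)%nat) n + f (S n - 1 - n)%nat)%C.
  rewrite <- (Csum_shift (fun k => f (S n - 1 - k)%nat) n).
  rewrite IHn, Cplus_comm. f_equal. f_equal; lia.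
  apply Csum_ext. intros k Hk. f_equal. lia.
Qed.

Lemma Csum_RtoC (f : nat -> R) (n : nat) : Csum (fun k => RtoC (f k)) (S n) = RtoC (sum_f_R0 f n).
Proof.
  induction n. simpl. ring.
  rewrite tech5, RtoC_plus, <- IHn. reflexivity.
Qed.

Lemma fst_Csum (f : nat -> C) (n : nat) : fst (Csum f (S n)) = sum_f_R0 (fun k => fst (f k)) n.
Proof. induction n; [simpl; ring|]. rewrite tech5, <- IHn. reflexivity. Qed.

Lemma snd_Csum (f : nat -> C) (n : nat) : snd (Csum f (S n)) = sum_f_R0 (fun k => snd (f k)) n.
Proof. induction n; [simpl; ring|]. rewrite tech5, <- IHn. reflexivity. Qed.

(* The translate of [w / 2^p] by the fraction [t / 2^p] of the period. *)
Definition pt (w : C) (p : nat) (t : R) : C := ((w + (0, 2 * PI * t)%R) / RtoC (2 ^ p))%C.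

Lemma pow2_neq_0 (p : nat) : 2 ^ p <> 0.
Proof. apply pow_nonzero; lra. Qed.

Lemma RtoC_neq_0 (x : R) : x <> 0 -> RtoC x <> 0%C.
Proof. intros H E. now apply RtoC_inj in E. Qed.

Lemma Rpow2_pos (p : nat) : 0 < 2 ^ p.
Proof. apply pow_lt; lra. Qed.

Lemma pt_pair (w : C) (p : nat) (t : R) :
  pt w p t = (fst w / 2 ^ p, (snd w + 2 * PI * t) / 2 ^ p).
Proof.
  assert (H := pow2_neq_0 p). unfold pt. destruct w as [x y].
  unfold Cdiv. rewrite <- RtoC_inv by auto.
  unfold Cmult, Cplus, RtoC; simpl. f_equal; field; auto.
Qed.

(** Iterated doubling: the two arguments produced from [pt w p k] are the translates [k] and
    [2^p + k] of the next level. *)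
Lemma coth2_sum (w : C) (p : nat) : 0 < fst w ->
  coth2 w = (/ RtoC (2 ^ p) * Csum (fun k => coth2 (pt w p (INR k))) (2 ^ p))%C.
Proof.
  intros Hw. induction p.
  - simpl Csum. unfold pt. simpl INR. simpl pow. rewrite Cplus_0_l.
    replace ((w + (0, 2 * PI * 0)%R) / 1)%C with w. field.
    destruct w; unfold Cdiv. rewrite <- RtoC_inv by lra. unfold Cmult, Cplus, RtoC; simpl. f_equal; field.
  - rewrite IHp. replace (2 ^ S p)%nat with (2 ^ p + 2 ^ p)%nat by (simpl; lia).
    rewrite Csum_add, <- Csum_plus.
    rewrite (Csum_ext _ (fun k => (/ 2 * (coth2 (pt w (S p) (INR k)) + coth2 (pt w (S p) (INR (2 ^ p + k)))))%C)).
    + rewrite Csum_scal. simpl pow. rewrite RtoC_mult. field. apply RtoC_neq_0, pow2_neq_0.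
    + intros k _. assert (H := pow2_neq_0 p). assert (Hp := Rpow2_pos p).
      rewrite coth2_double.
      * f_equal. f_equal; f_equal; rewrite !pt_pair.
        -- unfold Cdiv. rewrite <- RtoC_inv by lra. unfold Cmult, RtoC; simpl. f_equal; field; auto.
        -- unfold Cdiv. rewrite <- RtoC_inv by lra. unfold Cmult, Cplus, RtoC; simpl.
           rewrite plus_INR, pow_INR. change (INR 2) with 2. f_equal; field; auto.
      * rewrite pt_pair; simpl. now apply Rdiv_lt_0_compat.
Qed.

Lemma coth2_pt_period (w : C) (p : nat) (t : R) : coth2 (pt w p (t + 2 ^ p)) = coth2 (pt w p t).
Proof.
  unfold coth2. replace (Cexp (pt w p (t + 2 ^ p))) with (Cexp (pt w p t)); auto.
  rewrite !pt_pair. unfold Cexp; simpl.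
  replace ((snd w + 2 * PI * (t + 2 ^ p)) / 2 ^ p) with ((snd w + 2 * PI * t) / 2 ^ p + 2 * INR 1 * PI)
    by (simpl; field; apply pow2_neq_0).
  now rewrite cos_period, sin_period.
Qed.

(** Single translates decay too slowly for domination, but pairs [t], [-t] decay like [1 / t^2];
    periodicity moves the upper half of the residues modulo [2^(p+1)] to negative ones. The residues
    [2^p] and [- 2^p] coincide and the pairs count both, hence the subtracted term. *)
Lemma coth2_sum_sym (w : C) (p : nat) : 0 < fst w ->
  coth2 w = (/ RtoC (2 ^ S p) * (coth2 (pt w (S p) 0) - coth2 (pt w (S p) (2 ^ p))) +
    Csum (fun k => / RtoC (2 ^ S p) *
       (coth2 (pt w (S p) (INR (S k))) + coth2 (pt w (S p) (- INR (S k))))) (2 ^ p))%C.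
Proof.
  intros Hw. rewrite (coth2_sum w (S p) Hw).
  rewrite Csum_scal, <- Cmult_plus_distr_l. f_equal.
  replace (2 ^ S p)%nat with (2 ^ p + 2 ^ p)%nat by (simpl; lia).
  rewrite Csum_add, Csum_plus.
  assert (E := Csum_shift (fun k => coth2 (pt w (S p) (INR k))) (2 ^ p)).
  cbv beta in E. rewrite pow_INR in E. simpl (INR 0) in E. change (INR 2) with 2 in E.
  (* Reversed, the upper half lists the residues [2^(p+1) - (k+1)], that is [- (k+1)] up to a
     period. *)
  rewrite (Csum_rev (fun k => coth2 (pt w (S p) (INR (2 ^ p + k))))).
  rewrite (Csum_ext (fun k => coth2 (pt w (S p) (INR (2 ^ p + (2 ^ p - 1 - k)))))
     (fun k => coth2 (pt w (S p) (- INR (S k))))).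
  - replace (Csum (fun k => coth2 (pt w (S p) (INR k))) (2 ^ p)) with
     (coth2 (pt w (S p) 0) + Csum (fun k => coth2 (pt w (S p) (INR (S k)))) (2 ^ p) - coth2 (pt w (S p) (2 ^ p)))%C.
    ring. rewrite E. ring.
  - intros k Hk. rewrite <- (coth2_pt_period w (S p) (- INR (S k))). f_equal. f_equal.
    replace (2 ^ p + (2 ^ p - 1 - k))%nat with (2 ^ p + 2 ^ p - S k)%nat by lia.
    rewrite minus_INR by lia. rewrite plus_INR, pow_INR. change (INR 2) with 2. rewrite <- tech_pow_Rmult. ring.
Qed.

(* Product formula for the pair of translates by [+t] and [-t]; its shape is chosen so that
   each factor converges as [p] grows. *)
Definition pairterm (w : C) (p : nat) (t : R) : C :=
  (2 * (RtoC (2 ^ p) * (Cexp (w / RtoC (2 ^ p)) - Cexp (- (w / RtoC (2 ^ p)))))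
   / ((RtoC (2 ^ p) * (Cexp (w / 2 / RtoC (2 ^ p)) - Cexp (- (w / 2 / RtoC (2 ^ p))))) ^ 2
      + RtoC ((2 * (2 ^ p * sin (PI * t / 2 ^ p))) ^ 2)))%C.

(** The two exponentials are [H^2 U] and [H^2 / U]. Their common denominator satisfies [(H^2 U - 1)
    (H^2 / U - 1) / H^2 = (H - 1/H)^2 + (2 - U - 1/U)], and the last bracket is
    [4 sin^2 (pi t / 2^p)]. *)
Lemma coth2_pair (w : C) (p : nat) (t : R) : 0 < fst w ->
  (/ RtoC (2 ^ p) * (coth2 (pt w p t) + coth2 (pt w p (- t))))%C = pairterm w p t.
Proof.
  intros Hw. assert (Hp := Rpow2_pos p). assert (Hn := pow2_neq_0 p).
  assert (HnC : RtoC (2 ^ p) <> 0%C) by now apply RtoC_neq_0.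
  set (U := Cexp (0, 2 * PI * t / 2 ^ p)).
  assert (HU : (U * Cexp (0, - (2 * PI * t / 2 ^ p))%R)%C = 1%C).
  { unfold U. rewrite <- (Cexp_mult_opp (0, 2 * PI * t / 2 ^ p)). f_equal. f_equal.
    unfold Copp; simpl. now rewrite Ropp_0. }
  assert (HU0 : U <> 0%C) by apply Cexp_neq_0.
  set (H := Cexp (w / 2 / RtoC (2 ^ p))).
  assert (HH0 : H <> 0%C) by apply Cexp_neq_0.
  assert (EE : Cexp (w / RtoC (2 ^ p)) = (H * H)%C).
  { unfold H. rewrite <- Cexp_add. f_equal. field. auto. }
  assert (E1 : Cexp (pt w p t) = (H * H * U)%C).
  { rewrite <- EE. unfold U. rewrite <- Cexp_add. f_equal. rewrite pt_pair.
    unfold Cdiv. rewrite <- RtoC_inv by auto. unfold Cmult, Cplus, RtoC; destruct w; simpl.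
    f_equal; field; auto. }
  assert (E2 : Cexp (pt w p (- t)) = (H * H / U)%C).
  { rewrite <- EE. unfold Cdiv at 1. replace (/ U)%C with (Cexp (0, - (2 * PI * t / 2 ^ p))%R).
    - rewrite <- Cexp_add. f_equal. rewrite pt_pair.
      unfold Cdiv. rewrite <- RtoC_inv by auto. unfold Cmult, Cplus, RtoC; destruct w; simpl.
      f_equal; field; auto.
    - rewrite <- (Cmult_1_l (/ U)), <- HU. field. auto. }
  assert (P1 : 0 < fst (pt w p t)) by (rewrite pt_pair; simpl; now apply Rdiv_lt_0_compat).
  assert (P2 : 0 < fst (pt w p (- t))) by (rewrite pt_pair; simpl; now apply Rdiv_lt_0_compat).
  assert (N1 := Cexp_sub_1_neq_0 _ P1). assert (N2 := Cexp_sub_1_neq_0 _ P2).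
  rewrite E1 in N1. rewrite E2 in N2.
  assert (ES : RtoC ((2 * (2 ^ p * sin (PI * t / 2 ^ p))) ^ 2) = (RtoC (2 ^ p) ^ 2 * (2 - U - / U))%C).
  { replace (/ U)%C with (Cexp (0, - (2 * PI * t / 2 ^ p))%R).
    2:{ rewrite <- (Cmult_1_l (/ U)), <- HU. field. auto. }
    rewrite <- RtoC_pow. unfold U, Cexp; simpl fst; simpl snd. rewrite exp_0, cos_neg, sin_neg.
    replace (2 * PI * t / 2 ^ p) with (2 * (PI * t / 2 ^ p)) by (unfold Rdiv; ring).
    rewrite cos_2a_sin. unfold Cmult, Cminus, Cplus, Copp, RtoC; simpl. f_equal; ring. }
  unfold pairterm, coth2. rewrite ES, !Cexp_opp, EE, E1, E2. fold H.
  assert (N3 : ((H * H * U - 1) * (H * H / U - 1))%C <> 0%C) by now apply Cmult_neq_0.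
  replace ((RtoC (2 ^ p) * (H - / H)) ^ 2 + RtoC (2 ^ p) ^ 2 * (2 - U - / U))%C
    with (RtoC (2 ^ p) ^ 2 * ((H * H * U - 1) * (H * H / U - 1)) / (H * H))%C by (field; auto).
  field. repeat split; auto.
  intros Z. apply N2. replace (H * H / U - 1)%C with ((H * H - U) / U)%C by (field; auto).
  rewrite Z. field. auto.
Qed.

(** * Partial fractions of the hyperbolic cotangent *)

Lemma Series_truncate (a : nat -> R) (n : nat) :
  Series (fun k => if (k <? S n)%nat then a k else 0) = sum_f_R0 a n.
Proof.
  assert (E : ex_series (fun k => if (k <? S n)%nat then a k else 0)).
  { apply (ex_series_incr_n _ (S n)). apply ex_series_ext_R with (fun _ => 0).
    - intros k. destruct (Nat.ltb_spec (S n + k) (S n)); auto. lia.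
    - apply ex_series_ext_R with (fun k => 0 * (/ 2) ^ k). intros; ring.
      apply ex_series_scal_R, ex_series_geom. rewrite Rabs_pos_eq; lra. }
  rewrite (Series_incr_n _ (S n)); auto with arith. simpl Nat.pred.
  rewrite (Series_ext (fun k => if (S n + k <? S n)%nat then _ else 0) (fun k => 0 * 0)).
  - rewrite Series_scal_l, Rmult_0_l, Rplus_0_r. apply sum_eq. intros i Hi.
    destruct (Nat.ltb_spec i (S n)); auto. lia.
  - intros k. destruct (Nat.ltb_spec (S n + k) (S n)); [lia|ring].
Qed.

(** Tannery's theorem for finite sums of growing length, padded with zeros to become series. *)
Lemma sum_dominated_lim (f : nat -> nat -> R) (g M : nat -> R) (K0 : nat) (n : nat -> nat) :
  (forall k, is_lim_seq (fun p => f p k) (g k)) ->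
  eventually (fun p => forall k, (K0 <= k)%nat -> (k <= n p)%nat -> Rabs (f p k) <= M k) ->
  (forall k, 0 <= M k) -> ex_series M ->
  (forall k, eventually (fun p => (k <= n p)%nat)) ->
  ex_series g /\ is_lim_seq (fun p => sum_f_R0 (f p) (n p)) (Series g).
Proof.
  intros Hf Hd HM0 HM Hn.
  destruct (Series_dominated_lim (fun p k => if (k <? S (n p))%nat then f p k else 0) g M K0) as [H1 H2]; auto.
  - intros k. apply is_lim_seq_ext_loc with (fun p => f p k); auto.
    destruct (Hn k) as [P HP]. exists P. intros p Hp. specialize (HP p Hp).
    destruct (Nat.ltb_spec k (S (n p))); auto. lia.
  - destruct Hd as [P HP]. exists P. intros p Hp k Hk. specialize (HP p Hp k Hk).
    destruct (Nat.ltb_spec k (S (n p))). apply HP; lia. now rewrite Rabs_R0.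
  - split; auto. refine (is_lim_seq_ext _ _ _ _ H2). intros p. apply Series_truncate.
Qed.

(** * Complex limits and series, taken componentwise to agree with [CSeries] *)

Definition is_Clim (u : nat -> C) (l : C) : Prop :=
  is_lim_seq (fun n => fst (u n)) (fst l) /\ is_lim_seq (fun n => snd (u n)) (snd l).

Definition is_Cseries (a : nat -> C) (l : C) : Prop :=
  is_series (fun n => fst (a n)) (fst l) /\ is_series (fun n => snd (a n)) (snd l).

Lemma is_Clim_ext (u v : nat -> C) (l : C) : (forall n, u n = v n) -> is_Clim u l -> is_Clim v l.
Proof.
  intros H [H1 H2]; split.
  - refine (is_lim_seq_ext _ _ _ _ H1); intros n; now rewrite H.
  - refine (is_lim_seq_ext _ _ _ _ H2); intros n; now rewrite H.
Qed.

Lemma is_Clim_const (c : C) : is_Clim (fun _ => c) c.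
Proof. split; apply is_lim_seq_const. Qed.

Lemma is_Clim_RtoC (u : nat -> R) (l : R) : is_lim_seq u l -> is_Clim (fun n => RtoC (u n)) (RtoC l).
Proof. split; [exact H | apply is_lim_seq_const]. Qed.

Lemma is_Clim_plus (u v : nat -> C) (a b : C) :
  is_Clim u a -> is_Clim v b -> is_Clim (fun n => (u n + v n)%C) (a + b)%C.
Proof. intros [H1 H2] [H3 H4]; split; simpl; now apply is_lim_seq_plus'. Qed.

Lemma is_Clim_minus (u v : nat -> C) (a b : C) :
  is_Clim u a -> is_Clim v b -> is_Clim (fun n => (u n - v n)%C) (a - b)%C.
Proof. intros [H1 H2] [H3 H4]; split; simpl; now apply is_lim_seq_minus'. Qed.

Lemma is_Clim_mult (u v : nat -> C) (a b : C) :
  is_Clim u a -> is_Clim v b -> is_Clim (fun n => (u n * v n)%C) (a * b)%C.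
Proof.
  intros [H1 H2] [H3 H4]; split; simpl.
  apply is_lim_seq_minus'; now apply is_lim_seq_mult'.
  apply is_lim_seq_plus'; now apply is_lim_seq_mult'.
Qed.

Lemma is_Clim_inv (u : nat -> C) (a : C) :
  a <> 0%C -> is_Clim u a -> is_Clim (fun n => (/ u n)%C) (/ a)%C.
Proof.
  intros Ha [H1 H2].
  assert (D : fst a ^ 2 + snd a ^ 2 <> 0).
  { intros Z. apply Ha. destruct a as [x y]; simpl in *. unfold RtoC. f_equal; nra. }
  assert (L : is_lim_seq (fun n => fst (u n) ^ 2 + snd (u n) ^ 2) (fst a ^ 2 + snd a ^ 2)).
  { apply is_lim_seq_plus'; simpl; repeat apply is_lim_seq_mult'; auto; apply is_lim_seq_const. }
  split; simpl fst; simpl snd.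
  - now apply is_lim_seq_div'.
  - apply is_lim_seq_div'; auto. apply (is_lim_seq_opp _ (Finite (snd a))); auto.
Qed.

Lemma is_Clim_div (u v : nat -> C) (a b : C) :
  b <> 0%C -> is_Clim u a -> is_Clim v b -> is_Clim (fun n => (u n / v n)%C) (a / b)%C.
Proof. intros. apply is_Clim_mult; auto. now apply is_Clim_inv. Qed.

Lemma is_Clim_incr (u : nat -> C) (a : C) : is_Clim u a -> is_Clim (fun n => u (S n)) a.
Proof.
  intros [H1 H2]; split.
  apply (is_lim_seq_incr_1 (fun n => fst (u n))); auto.
  apply (is_lim_seq_incr_1 (fun n => snd (u n))); auto.
Qed.

Lemma is_Clim_Cmod_bound (u : nat -> C) (a : C) (B : R) :
  is_Clim u a -> Cmod a < B -> eventually (fun n => Cmod (u n) <= B).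
Proof.
  intros [H1 H2] HB.
  assert (L : is_lim_seq (fun n => Cmod (u n)) (Cmod a)).
  { unfold Cmod. apply (is_lim_seq_continuous sqrt).
    - apply continuity_pt_sqrt. nra.
    - apply is_lim_seq_plus'; simpl; repeat apply is_lim_seq_mult'; auto; apply is_lim_seq_const. }
  apply is_lim_seq_spec in L.
  assert (E : 0 < B - Cmod a) by lra.
  destruct (L (mkposreal _ E)) as [P HP]. exists P. intros n Hn. specialize (HP n Hn). simpl in HP.
  apply Rabs_def2 in HP. lra.
Qed.

Lemma Rabs_fst_le (z : C) : Rabs (fst z) <= Cmod z.
Proof. eapply Rle_trans; [apply Rmax_l | apply Rmax_Cmod]. Qed.

Lemma Rabs_snd_le (z : C) : Rabs (snd z) <= Cmod z.
Proof. eapply Rle_trans; [apply Rmax_r | apply Rmax_Cmod]. Qed.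

(** The limit [l] of the finite sums is known beforehand; by uniqueness of limits the series of
    termwise limits must have [l] as its sum. *)
Lemma Csum_dominated_lim (f : nat -> nat -> C) (g : nat -> C) (l : C) (M : nat -> R) (K0 : nat) (n : nat -> nat) :
  (forall k, is_Clim (fun p => f p k) (g k)) ->
  eventually (fun p => forall k, (K0 <= k)%nat -> (k <= n p)%nat -> Cmod (f p k) <= M k) ->
  (forall k, 0 <= M k) -> ex_series M ->
  (forall k, eventually (fun p => (k <= n p)%nat)) ->
  is_Clim (fun p => Csum (f p) (S (n p))) l -> is_Cseries g l.
Proof.
  intros Hf [P HP] HM0 HM Hn [L1 L2].
  destruct (sum_dominated_lim (fun p k => fst (f p k)) (fun k => fst (g k)) M K0 n) as [E1 M1]; auto.
  - intros k; apply Hf.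
  - exists P. intros p Hp k Hk Hk2. eapply Rle_trans; [apply Rabs_fst_le | auto].
  - destruct (sum_dominated_lim (fun p k => snd (f p k)) (fun k => snd (g k)) M K0 n) as [E2 M2]; auto.
    + intros k; apply Hf.
    + exists P. intros p Hp k Hk Hk2. eapply Rle_trans; [apply Rabs_snd_le | auto].
    + split.
      * apply is_lim_seq_ext with (v := fun p => sum_f_R0 (fun k => fst (f p k)) (n p)) in L1;
          [|intros p; apply fst_Csum].
        apply is_lim_seq_unique in L1. apply is_lim_seq_unique in M1. rewrite L1 in M1.
        injection M1 as M1. rewrite M1. now apply Series_correct.
      * apply is_lim_seq_ext with (v := fun p => sum_f_R0 (fun k => snd (f p k)) (n p)) in L2;
          [|intros p; apply snd_Csum].
        apply is_lim_seq_unique in L2. apply is_lim_seq_unique in M2. rewrite L2 in M2.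
        injection M2 as M2. rewrite M2. now apply Series_correct.
Qed.

Lemma is_lim_seq_inv_pow2 : is_lim_seq (fun p => / 2 ^ p) 0.
Proof.
  apply is_lim_seq_ext with (fun p => (/ 2) ^ p). intros p. apply pow_inv.
  apply is_lim_seq_geom. rewrite Rabs_pos_eq; lra.
Qed.

(** A difference quotient at [0] with step [2^-p]. The limits of [2^p (e^(z / 2^p) - 1)] and
    [2^p sin (t / 2^p)] are instances. *)
Lemma is_lim_seq_diff_quot (F : R -> R) (d : R) :
  is_derive F 0 d -> F 0 = 0 -> is_lim_seq (fun p => 2 ^ p * F (/ 2 ^ p)) d.
Proof.
  intros HF F0. apply is_derive_Reals in HF. apply is_lim_seq_spec. intros eps.
  destruct (HF eps (cond_pos eps)) as [delta Hd].
  assert (L := is_lim_seq_inv_pow2). apply is_lim_seq_spec in L.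
  destruct (L delta) as [P HP]. exists P. intros p Hp. specialize (HP p Hp).
  rewrite Rminus_0_r in HP. assert (H := pow2_neq_0 p).
  specialize (Hd (/ 2 ^ p) (Rinv_neq_0_compat _ H) HP).
  rewrite Rplus_0_l, F0, Rminus_0_r in Hd. unfold Rdiv in Hd. rewrite Rinv_inv in Hd.
  now rewrite Rmult_comm.
Qed.

Lemma is_Clim_Cexp_sub_1 (z : C) :
  is_Clim (fun p => (RtoC (2 ^ p) * (Cexp (z / RtoC (2 ^ p)) - 1))%C) z.
Proof.
  destruct z as [x y].
  apply is_Clim_ext with (fun p => (2 ^ p * (exp (x * / 2 ^ p) * cos (y * / 2 ^ p) - 1),
     2 ^ p * (exp (x * / 2 ^ p) * sin (y * / 2 ^ p)))).
  - intros p. unfold Cdiv. rewrite <- RtoC_inv by apply pow2_neq_0.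
    unfold Cexp, Cmult, Cminus, Cplus, Copp, RtoC; simpl.
    replace (x * / 2 ^ p - y * 0) with (x * / 2 ^ p) by ring.
    replace (x * 0 + y * / 2 ^ p) with (y * / 2 ^ p) by ring. f_equal; ring.
  - split; simpl.
    + apply (is_lim_seq_diff_quot (fun h => exp (x * h) * cos (y * h) - 1) x).
      * auto_derive; auto. rewrite !Rmult_0_r, exp_0, cos_0, sin_0. ring.
      * rewrite !Rmult_0_r, exp_0, cos_0. ring.
    + apply (is_lim_seq_diff_quot (fun h => exp (x * h) * sin (y * h)) y).
      * auto_derive; auto. rewrite !Rmult_0_r, exp_0, cos_0, sin_0. ring.
      * rewrite !Rmult_0_r, exp_0, sin_0. ring.
Qed.

Lemma is_Clim_Csinh (z : C) :
  is_Clim (fun p => (RtoC (2 ^ p) * (Cexp (z / RtoC (2 ^ p)) - Cexp (- (z / RtoC (2 ^ p)))))%C) (2 * z)%C.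
Proof.
  replace (2 * z)%C with (z - (- z))%C by ring.
  refine (is_Clim_ext _ _ _ _ (is_Clim_minus _ _ _ _ (is_Clim_Cexp_sub_1 z) (is_Clim_Cexp_sub_1 (- z)))).
  intros p. cbv beta.
  replace (- z / RtoC (2 ^ p))%C with (- (z / RtoC (2 ^ p)))%C by (unfold Cdiv; ring). ring.
Qed.

Lemma is_lim_seq_sin_pow2 (t : R) : is_lim_seq (fun p => 2 ^ p * sin (t / 2 ^ p)) t.
Proof.
  apply (is_lim_seq_diff_quot (fun h => sin (t * h)) t).
  - auto_derive; auto. rewrite Rmult_0_r, cos_0. ring.
  - now rewrite Rmult_0_r, sin_0.
Qed.

(** As [PI <= 4] gives [t <= 2], the Taylor lower bound yields [t - t^3 / 6 >= t / 3], while its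
    next two terms have a nonnegative sum. The constant is good enough because [PI / 3 >= 1]. *)
Lemma sin_ge_third (t : R) : 0 <= t <= PI / 2 -> t / 3 <= sin t.
Proof.
  intros [H1 H2]. assert (HP := PI_4).
  destruct (SIN t) as [H _]; try lra.
  unfold sin_lb, sin_approx, sin_term in H. simpl in H.
  eapply Rle_trans; [|exact H].
  assert (t <= 2) by lra.
  assert (E : t * t <= 4) by nra.
  assert (E2 : 0 <= t * (t * t) * (t * t)) by (repeat apply Rmult_le_pos; lra).
  assert (E3 : 0 <= t * (4 - t * t)) by (apply Rmult_le_pos; lra).
  assert (E4 : 0 <= (t * (t * t) * (t * t)) * (4 - t * t)) by (apply Rmult_le_pos; lra).
  field_simplify. nra.
Qed.

Lemma is_Clim_pairterm (w : C) (t : R) :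
  (w * w + RtoC ((2 * PI * t) ^ 2))%C <> 0%C ->
  is_Clim (fun p => pairterm w p t) (4 * w / (w * w + RtoC ((2 * PI * t) ^ 2)))%C.
Proof.
  intros HD. unfold pairterm. replace (4 * w)%C with (2 * (2 * w))%C by ring.
  apply is_Clim_div; auto.
  - apply is_Clim_mult. apply is_Clim_const. apply is_Clim_Csinh.
  - apply is_Clim_plus.
    + assert (L := is_Clim_Csinh (w / 2)). replace (2 * (w / 2))%C with w in L by field.
      refine (is_Clim_ext _ _ _ _ (is_Clim_mult _ _ _ _ L L)). intros p. simpl. ring.
    + apply is_Clim_RtoC. replace (2 * PI * t) with (2 * (PI * t)) by ring.
      assert (L := is_lim_seq_mult' _ _ _ _ (is_lim_seq_const 2) (is_lim_seq_sin_pow2 (PI * t))).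
      replace ((2 * (PI * t)) ^ 2) with ((2 * (PI * t)) * (2 * (PI * t))) by ring.
      refine (is_lim_seq_ext _ _ _ _ (is_lim_seq_mult' _ _ _ _ L L)). intros p. simpl. ring.
Qed.

Lemma sq_add_neq_0 (w : C) (r : R) : 0 < fst w -> (w * w + RtoC (r ^ 2))%C <> 0%C.
Proof.
  intros Hw H. destruct w as [x y]; simpl in Hw.
  unfold Cmult, Cplus, RtoC in H; simpl in H. injection H as H1 H2.
  assert (y = 0) by nra. subst. nra.
Qed.

Lemma Cmod_sub_le (a b : C) : Cmod b - Cmod a <= Cmod (a + b).
Proof.
  assert (H := Cmod_triangle (a + b) (- a)). rewrite Cmod_opp in H.
  replace (a + b + - a)%C with b in H by ring. lra.
Qed.

(** [Csum_dominated_lim] applied to [coth2_sum_sym]: the pairs give the series, the two unpaired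
    terms give [2 / w]. *)
Lemma coth2_expansion (w : C) : 0 < fst w ->
  is_Cseries (fun k => (4 * w / (w * w + RtoC ((2 * PI * INR (S k)) ^ 2)))%C) (coth2 w - 2 / w)%C.
Proof.
  intros Hw.
  assert (Hw0 : w <> 0%C) by (intros Z; subst; simpl in Hw; lra).
  set (W := Cmod w).
  (* Beyond [K0] the index [x = k + 1] exceeds [|w| + 1]. In the denominator of [pairterm] the sine
     part, at least [4 x^2], then outweighs the hyperbolic part, eventually at most
     [(|w| + 1)^2 <= x^2]. *)
  destruct (nfloor_ex (W + 1)) as [K0 [_ HK0]].
  { assert (H := Cmod_ge_0 w). unfold W. lra. }
  assert (P2 : forall p, S (Nat.pred (2 ^ p)) = (2 ^ p)%nat).
  { intros p. assert (H := Nat.pow_nonzero 2 p). lia. }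
  apply (Csum_dominated_lim (fun p k => pairterm w (S p) (INR (S k))) _ _
     (fun k => (2 * W + 1) * / INR (S k) ^ 2) (S K0) (fun p => Nat.pred (2 ^ p))).
  - intros k. apply (is_Clim_incr (fun p => pairterm w p (INR (S k)))).
    apply is_Clim_pairterm. now apply sq_add_neq_0.
  - assert (B1 : eventually (fun p => Cmod (RtoC (2 ^ p) * (Cexp (w / RtoC (2 ^ p)) - Cexp (- (w / RtoC (2 ^ p))))) <= 2 * W + 1)).
    { apply is_Clim_Cmod_bound with (1 := is_Clim_Csinh w).
      rewrite Cmod_mult, Cmod_R, Rabs_pos_eq by lra. fold W. lra. }
    assert (B2 : eventually (fun p => Cmod (RtoC (2 ^ p) * (Cexp (w / 2 / RtoC (2 ^ p)) - Cexp (- (w / 2 / RtoC (2 ^ p))))) <= W + 1)).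
    { apply is_Clim_Cmod_bound with (1 := is_Clim_Csinh (w / 2)).
      replace (2 * (w / 2))%C with w by field. fold W. lra. }
    destruct B1 as [P1 B1]. destruct B2 as [P3 B2].
    exists (max P1 P3). intros p Hp k Hk Hk2.
    specialize (B1 (S p) ltac:(lia)). specialize (B2 (S p) ltac:(lia)).
    set (x := INR (S k)).
    assert (Hx : W + 1 <= x).
    { apply Rle_trans with (INR K0 + 1). lra. rewrite <- S_INR. apply le_INR. lia. }
    assert (Wpos : 0 <= W) by apply Cmod_ge_0.
    assert (Hxn : x <= 2 ^ p).
    { unfold x. change 2 with (INR 2). rewrite <- pow_INR. apply le_INR. rewrite <- P2. lia. }
    unfold pairterm.
    set (A := (RtoC (2 ^ S p) * (Cexp (w / RtoC (2 ^ S p)) - Cexp (- (w / RtoC (2 ^ S p)))))%C) in *.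
    set (D := (RtoC (2 ^ S p) * (Cexp (w / 2 / RtoC (2 ^ S p)) - Cexp (- (w / 2 / RtoC (2 ^ S p)))))%C) in *.
    assert (Hs : 2 * x <= 2 * (2 ^ S p * sin (PI * x / 2 ^ S p))).
    { assert (Hq := Rpow2_pos (S p)). assert (Hpi := PI_RGT_0). assert (Hpi3 := PI2_3_2).
      assert (T := sin_ge_third (PI * x / 2 ^ S p)).
      assert (PI * x / 2 ^ S p / 3 <= sin (PI * x / 2 ^ S p)).
      { apply T. split. apply Rmult_le_pos. nra. apply Rlt_le, Rinv_0_lt_compat; auto.
        apply Rmult_le_reg_r with (2 ^ S p); auto.
        replace (PI * x / 2 ^ S p * 2 ^ S p) with (PI * x) by (field; lra).
        rewrite <- tech_pow_Rmult. nra. }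
      apply Rmult_le_compat_l with (r := 2 ^ S p) in H; [|lra].
      replace (2 ^ S p * (PI * x / 2 ^ S p / 3)) with (PI * x / 3) in H by (field; lra). nra. }
    assert (HD : 2 * x ^ 2 <= Cmod (D ^ 2 + RtoC ((2 * (2 ^ S p * sin (PI * x / 2 ^ S p))) ^ 2))).
    { eapply Rle_trans; [|apply Cmod_sub_le]. rewrite Cmod_R, Cmod_pow, Rabs_pos_eq by apply pow2_ge_0.
      assert (Dpos := Cmod_ge_0 D).
      assert (Q1 := pow_incr _ _ 2 (conj Dpos B2)).
      assert (Q2 := pow_incr (W + 1) x 2 ltac:(lra)).
      assert (X0 : 0 <= 2 * x) by lra. assert (Q3 := pow_incr _ _ 2 (conj X0 Hs)).
      replace ((2 * x) ^ 2) with (4 * x ^ 2) in Q3 by ring. assert (Q4 := pow2_ge_0 x). lra. }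
    rewrite Cmod_div.
    + rewrite Cmod_mult, Cmod_R, (Rabs_pos_eq 2) by lra.
      apply Rle_trans with (2 * (2 * W + 1) * / (2 * x ^ 2)).
      * apply Rmult_le_compat; try (apply Rmult_le_pos; [lra | apply Cmod_ge_0]).
        -- apply Rlt_le, Rinv_0_lt_compat. nra.
        -- lra.
        -- apply Rinv_le_contravar; nra.
      * apply Req_le. field. lra.
    + intros Z. rewrite Z, Cmod_0 in HD. nra.
  - intros k. apply Rmult_le_pos. unfold W. assert (H := Cmod_ge_0 w). lra.
    apply Rlt_le, Rinv_0_lt_compat, pow_lt, INR_S_pos.
  - apply ex_series_scal_R, ex_series_inv_sq.
  - intros k. exists k. intros p Hp. assert (H := Nat.pow_gt_lin_r 2 p). lia.
  - apply is_Clim_ext with (fun p => (coth2 w - / RtoC (2 ^ S p) * (coth2 (pt w (S p) 0) - coth2 (pt w (S p) (2 ^ p))))%C).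
    + intros p. rewrite P2, (coth2_sum_sym w p Hw) at 1.
      rewrite (Csum_ext _ (fun k => pairterm w (S p) (INR (S k)))). ring.
      intros k _. now apply coth2_pair.
    + apply is_Clim_minus. apply is_Clim_const.
      (* The unpaired terms: the one at [0] tends to [2 / w] ([L1]). The one at [2^p] is a translate
         by [i pi], so its [coth2] is [(e - 1) / (e + 1)], and it tends to [0] ([L2]). *)
      assert (LE : is_Clim (fun p => Cexp (w / RtoC (2 ^ p))) 1).
      { replace (RtoC 1) with (1 + 0 * w)%C by ring.
        refine (is_Clim_ext _ _ _ _ (is_Clim_plus _ _ _ _ (is_Clim_const 1)
          (is_Clim_mult _ _ _ _ (is_Clim_RtoC _ _ is_lim_seq_inv_pow2) (is_Clim_Cexp_sub_1 w)))).
        intros p. assert (H := RtoC_neq_0 _ (pow2_neq_0 p)).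
        rewrite RtoC_inv by apply pow2_neq_0. field. auto. }
      assert (L1 : is_Clim (fun p => ((Cexp (w / RtoC (2 ^ p)) + 1) / (RtoC (2 ^ p) * (Cexp (w / RtoC (2 ^ p)) - 1)))%C) (2 / w)%C).
      { apply is_Clim_div; auto. replace (RtoC 2) with (1 + 1)%C by (rewrite <- RtoC_plus; f_equal; ring).
        apply is_Clim_plus; auto. apply is_Clim_const. apply is_Clim_Cexp_sub_1. }
      assert (L2 : is_Clim (fun p => (RtoC (/ 2 ^ p) * ((Cexp (w / RtoC (2 ^ p)) - 1) / (Cexp (w / RtoC (2 ^ p)) + 1)))%C) 0%C).
      { replace (RtoC 0) with (0 * ((1 - 1) / (1 + 1)))%C by ring.
        apply is_Clim_mult. apply is_Clim_RtoC, is_lim_seq_inv_pow2.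
        apply is_Clim_div. rewrite <- RtoC_plus. apply RtoC_neq_0; lra.
        apply is_Clim_minus; auto. apply is_Clim_const.
        apply is_Clim_plus; auto. apply is_Clim_const. }
      apply is_Clim_incr in L1. apply is_Clim_incr in L2.
      replace (2 / w)%C with (2 / w - 0)%C by ring.
      refine (is_Clim_ext _ _ _ _ (is_Clim_minus _ _ _ _ L1 L2)).
      intros p. assert (H := pow2_neq_0 (S p)). assert (HC := RtoC_neq_0 _ H).
      assert (Q : 0 < fst (w / RtoC (2 ^ S p))%C).
      { unfold Cdiv. rewrite <- RtoC_inv by auto. destruct w; simpl fst in *; simpl snd.
        rewrite Rmult_0_r, Rminus_0_r. apply Rmult_lt_0_compat; auto. apply Rinv_0_lt_compat, (Rpow2_pos (S p)). }
      assert (N1 := Cexp_sub_1_neq_0 _ Q). assert (N2 := Cexp_add_1_neq_0 _ Q).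
      unfold coth2.
      replace (pt w (S p) 0) with (w / RtoC (2 ^ S p))%C.
      2:{ unfold pt. rewrite Rmult_0_r. f_equal. change (0, 0) with (RtoC 0). ring. }
      replace (pt w (S p) (2 ^ p)) with (w / RtoC (2 ^ S p) + (0, PI)%R)%C.
      2:{ rewrite pt_pair. unfold Cdiv. rewrite <- RtoC_inv by auto. destruct w.
          unfold Cmult, Cplus, RtoC; simpl. assert (Hq := pow2_neq_0 p). f_equal; field; auto. }
      rewrite Cexp_add, Cexp_iPI, RtoC_inv by auto.
      set (e := Cexp (w / RtoC (2 ^ S p))) in *. field. repeat split; auto.
      intros Z. apply N2. transitivity (- 0)%C; [rewrite <- Z|]; ring.
Qed.

(** * Partial fractions of the hyperbolic sine, and even zeta values *)

Definition coth2R (x : R) : R := (exp x + 1) / (exp x - 1).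

Lemma exp_sub_1_pos (x : R) : 0 < x -> 0 < exp x - 1.
Proof. intros H. assert (F := exp_ineq1 x ltac:(lra)). lra. Qed.

Lemma coth2_RtoC (x : R) : 0 < x -> coth2 (RtoC x) = RtoC (coth2R x).
Proof.
  intros Hx. assert (H := exp_sub_1_pos x Hx).
  unfold coth2, coth2R. replace (Cexp x) with (RtoC (exp x)).
  - rewrite RtoC_div by lra. now rewrite RtoC_plus, RtoC_minus.
  - unfold Cexp, RtoC; simpl. rewrite cos_0, sin_0. f_equal; ring.
Qed.

Lemma sq_add_sq_pos (x r : R) : 0 < x -> 0 < x * x + r ^ 2.
Proof. intros H. assert (G := pow2_ge_0 r). nra. Qed.

Lemma coth2R_expansion (x : R) : 0 < x ->
  is_series (fun k => 4 * x / (x * x + (2 * PI * INR (S k)) ^ 2)) (coth2R x - 2 / x).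
Proof.
  intros Hx. destruct (coth2_expansion (RtoC x) Hx) as [H _].
  rewrite coth2_RtoC, <- RtoC_div, <- RtoC_minus in H; auto; try lra.
  refine (is_series_ext _ _ _ _ H). intros k. cbv beta.
  rewrite <- !RtoC_mult, <- RtoC_plus, <- RtoC_div; auto.
  apply Rgt_not_eq, sq_add_sq_pos; auto.
Qed.

Lemma inv_sinh_term_bound (x r : R) : 0 < x -> 0 < r ->
  0 < 2 * x / (x ^ 2 + (PI * r) ^ 2) <= 2 * x * / r ^ 2.
Proof.
  intros Hx Hr. assert (HP := PI2_3_2). split.
  - apply Rdiv_lt_0_compat; nra.
  - apply Rmult_le_compat_l; [lra|]. apply Rinv_le_contravar. nra.
    rewrite Rpow_mult_distr. assert (0 < r ^ 2) by nra. assert (1 <= PI ^ 2) by nra.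
    assert (0 <= (PI ^ 2 - 1) * r ^ 2) by (apply Rmult_le_pos; lra). assert (G := pow2_ge_0 x). lra.
Qed.

(** The left side is [1 / (2 sinh x)], and [1 / sinh x = coth (x / 2) - coth x]. In [Series_alt] the
    even indices carry the expansion at [x], the full series the one at [2 x]. *)
Lemma inv_sinh_expansion (x : R) : 0 < x ->
  exp (- x) / (1 - exp (- (2 * x))) =
  / 2 * (/ x + Series (fun k => (-1) ^ S k * (2 * x / (x ^ 2 + (PI * INR (S k)) ^ 2)))).
Proof.
  intros Hx. set (a := fun k => 2 * x / (x ^ 2 + (PI * INR (S k)) ^ 2)).
  assert (Ba : forall k, 0 < a k <= 2 * x * / INR (S k) ^ 2).
  { intros k. apply inv_sinh_term_bound; auto. apply INR_S_pos. }
  assert (H1 := coth2R_expansion x Hx). assert (H2 := coth2R_expansion (2 * x) ltac:(lra)).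
  assert (S1 : Series (fun n => a (2 * n + 1)%nat) = / 2 * (coth2R x - 2 / x)).
  { rewrite <- (is_series_unique _ _ H1), <- Series_scal_l. apply Series_ext. intros n. unfold a.
    replace (S (2 * n + 1)) with (2 * S n)%nat by lia. rewrite mult_INR. change (INR 2) with 2.
    assert (G := sq_add_sq_pos x (2 * PI * INR (S n)) Hx). field; repeat split; apply Rgt_not_eq; lra. }
  assert (S2 : Series a = coth2R (2 * x) - 2 / (2 * x)).
  { rewrite <- (is_series_unique _ _ H2). apply Series_ext. intros n. unfold a.
    assert (G := sq_add_sq_pos x (PI * INR (S n)) Hx). field; repeat split; apply Rgt_not_eq; lra. }
  change (fun k => (-1) ^ S k * (2 * x / (x ^ 2 + (PI * INR (S k)) ^ 2))) with (fun k => (-1) ^ S k * a k).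
  rewrite Series_alt, S1, S2.
  - unfold coth2R. assert (E1 := exp_sub_1_pos x Hx). assert (E2 := exp_sub_1_pos (2 * x) ltac:(lra)).
    rewrite !exp_Ropp. replace (2 * x) with (x + x) in * by ring. rewrite exp_plus in *.
    field. repeat split; lra || nra.
  - apply ex_series_dom with (fun k => 2 * x * / INR (S k) ^ 2).
    + intros k. specialize (Ba k). rewrite Rabs_Rabsolu, Rabs_pos_eq; lra.
    + apply ex_series_scal_R, ex_series_inv_sq.
  - apply ex_series_dom with (fun k => 2 * x * / INR (S k) ^ 2).
    + intros k. specialize (Ba (2 * k + 1)%nat). rewrite Rabs_pos_eq by lra.
      eapply Rle_trans. apply Ba. apply Rmult_le_compat_l. lra.
      apply Rinv_le_contravar. apply pow_lt, INR_S_pos.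
      apply pow_incr. split. apply Rlt_le, INR_S_pos. apply le_INR. lia.
    + apply ex_series_scal_R, ex_series_inv_sq.
Qed.

(* Taylor coefficients of [x e^x / (e^x - 1)] in terms of zeta values. *)
Definition zeta_even_coef (n : nat) : R :=
  match n with
  | O => 1
  | S p => (-1) ^ p * 2 * zeta_nat (2 * S p) / (2 * PI) ^ (2 * S p)
  end.

(** The odd part of [x e^x / (e^x - 1)] is [x / 2], whence the single odd coefficient; the even part
    is [(x / 2) coth (x / 2)]. *)
Definition todd_coef (k : nat) : R :=
  if Nat.even k then zeta_even_coef (Nat.div2 k) else if (k =? 1)%nat then / 2 else 0.

Lemma todd_coef_even (n : nat) : todd_coef (2 * n) = zeta_even_coef n.
Proof. unfold todd_coef. now rewrite Nat.even_mul, Nat.div2_double. Qed.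

Lemma todd_coef_odd (n : nat) : todd_coef (2 * n + 1) = if (n =? 0)%nat then / 2 else 0.
Proof.
  unfold todd_coef. rewrite Nat.add_1_r, Nat.even_succ, Nat.odd_mul. simpl Nat.odd. simpl andb.
  destruct n; auto.
Qed.

Lemma zeta_nat_bound (s : nat) : (2 <= s)%nat -> 0 <= zeta_nat s <= zeta_nat 2.
Proof.
  intros Hs. unfold zeta_nat. split.
  - rewrite <- (Rmult_0_l (Series (fun n => / INR (S n) ^ s))), <- Series_scal_l.
    apply Series_le. intros n. destruct (inv_pow_le_inv_sq s n Hs). lra. now apply ex_series_inv_pow.
  - apply Series_le. intros n. destruct (inv_pow_le_inv_sq s n Hs). lra. apply ex_series_inv_sq.
Qed.

(** A uniform bound makes the radius of convergence at least [1]. The true radius is [2 pi], but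
    comparing coefficients needs only a neighbourhood of [0]. *)
Lemma todd_coef_bound (k : nat) : Rabs (todd_coef k) <= 1 + 2 * zeta_nat 2.
Proof.
  assert (Z2 := zeta_nat_bound 2 ltac:(lia)).
  unfold todd_coef. destruct (Nat.even k).
  - destruct (Nat.div2 k) as [|p].
    + simpl. rewrite Rabs_R1. lra.
    + assert (Z := zeta_nat_bound (2 * S p) ltac:(lia)).
      unfold zeta_even_coef. assert (HP := PI2_3_2). set (s := (2 * S p)%nat) in *.
      assert (HR : 1 <= (2 * PI) ^ s) by (apply pow_R1_Rle; lra).
      unfold Rdiv. rewrite !Rabs_mult, pow_1_abs, Rabs_inv.
      rewrite (Rabs_pos_eq 2), (Rabs_pos_eq (zeta_nat s)), (Rabs_pos_eq (_ ^ _)) by lra.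
      assert (HI : / (2 * PI) ^ s <= 1) by (rewrite <- Rinv_1; apply Rinv_le_contravar; lra).
      assert (0 < / (2 * PI) ^ s) by (apply Rinv_0_lt_compat; lra). nra.
  - destruct (k =? 1)%nat; [rewrite Rabs_pos_eq by lra | rewrite Rabs_R0]; lra.
Qed.

Lemma CV_radius_ge_1 (a : nat -> R) (M : R) :
  (forall n, Rabs (a n) <= M) -> Rbar_le 1 (CV_radius a).
Proof.
  intros H. apply (CV_radius_bounded a). exists M. intros n. now rewrite pow1, Rmult_1_r.
Qed.

Lemma CV_radius_inside_1 (a : nat -> R) (M x : R) :
  (forall n, Rabs (a n) <= M) -> Rabs x < 1 -> Rbar_lt (Rabs x) (CV_radius a).
Proof. intros H Hx. apply Rbar_lt_le_trans with 1; auto. now apply CV_radius_ge_1 with M. Qed.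

(** Each partial fraction times [x / 2] equals [2 r / (1 + r)] with [r = x^2 / (2 pi l)^2], a
    geometric series. Summing over [l] first collects the coefficient of [x^(2 p)] as a multiple of
    [zeta (2 p)]. *)
Lemma zeta_even_pseries (x : R) : 0 < x < 1 ->
  ex_pseries zeta_even_coef (x ^ 2) /\ PSeries zeta_even_coef (x ^ 2) = x / 2 * coth2R x.
Proof.
  intros Hx. assert (HP := PI2_3_2).
  assert (X2 : 0 < x ^ 2 < 1) by nra.
  set (r := fun l => x ^ 2 / (2 * PI * INR (S l)) ^ 2).
  assert (Hr : forall l, 0 < r l <= x ^ 2 * / INR (S l) ^ 2).
  { intros l. assert (Q := INR_S_pos l). unfold r. split.
    - apply Rdiv_lt_0_compat. lra. apply pow_lt. nra.
    - apply Rmult_le_compat_l. lra. apply Rinv_le_contravar. nra. rewrite Rpow_mult_distr.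
      assert (1 <= (2 * PI) ^ 2) by nra. assert (0 <= ((2 * PI) ^ 2 - 1) * INR (S l) ^ 2) by (apply Rmult_le_pos; nra). lra. }
  assert (Hr1 : forall l, r l < 1).
  { intros l. destruct (Hr l) as [_ H]. destruct (inv_pow_le_inv_sq 2 l ltac:(lia)) as [P _].
    assert (/ INR (S l) ^ 2 <= 1).
    { rewrite <- Rinv_1. apply Rinv_le_contravar. lra. apply pow_R1_Rle, INR_S_ge_1. } nra. }
  destruct (Series_swap (fun l p => (-1) ^ p * 2 * r l ^ S p) (fun l => / INR (S l) ^ 2)
     (fun p => 2 * (x ^ 2) ^ S p)) as [E1 [E2 E3]].
  - intros l p. rewrite !Rabs_mult, pow_1_abs, (Rabs_pos_eq 2) by lra.
    destruct (Hr l) as [R0 R1].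
    rewrite Rabs_pos_eq by (apply pow_le; lra).
    apply Rle_trans with (1 * 2 * (x ^ 2 * / INR (S l) ^ 2) ^ S p).
    apply Rmult_le_compat_l. lra. apply pow_incr; lra.
    rewrite Rpow_mult_distr. rewrite <- pow_inv, <- !pow_mult.
    assert (Q : (/ INR (S l)) ^ (2 * S p) <= (/ INR (S l)) ^ 2).
    { rewrite !pow_inv. apply inv_pow_le_inv_sq. lia. }
    assert (0 < x ^ (2 * S p)) by (apply pow_lt; lra). nra.
  - apply ex_series_inv_sq.
  - apply ex_series_ext_R with (fun p => 2 * x ^ 2 * (x ^ 2) ^ p). intros p; simpl; ring.
    apply ex_series_scal_R, ex_series_geom. rewrite Rabs_pos_eq; lra.
  - intros n. apply Rlt_le, Rinv_0_lt_compat, pow_lt, INR_S_pos.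
  - intros n. apply Rmult_le_pos. lra. apply pow_le; lra.
  - assert (S1 : forall l, Series (fun p => (-1) ^ p * 2 * r l ^ S p) = x / 2 * (4 * x / (x * x + (2 * PI * INR (S l)) ^ 2))).
    { intros l. assert (R1 := Hr l). assert (R2 := Hr1 l).
      rewrite (Series_ext _ (fun p => (2 * r l) * (- r l) ^ p)).
      - rewrite Series_scal_l, (is_series_unique _ (/ (1 - - r l))) by (apply is_series_geom; rewrite Rabs_Ropp, Rabs_pos_eq; lra).
        unfold r. assert (Q := INR_S_pos l). assert (G := sq_add_sq_pos x (2 * PI * INR (S l)) ltac:(lra)).
        assert (Q2 : 0 < (2 * PI * INR (S l)) ^ 2) by (apply pow_lt, Rmult_lt_0_compat; lra).
        set (q := (2 * PI * INR (S l)) ^ 2) in *. field. repeat split; apply Rgt_not_eq; lra.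
      - intros p. replace (- r l) with (-1 * r l) by ring. rewrite Rpow_mult_distr. simpl. ring. }
    assert (S2 : forall p, Series (fun l => (-1) ^ p * 2 * r l ^ S p) = zeta_even_coef (S p) * (x ^ 2) ^ S p).
    { intros p. unfold zeta_even_coef, zeta_nat. unfold Rdiv.
      replace ((-1) ^ p * 2 * Series (fun n => / INR (S n) ^ (2 * S p)) * / (2 * PI) ^ (2 * S p) * (x ^ 2) ^ S p)
        with ((-1) ^ p * 2 * / (2 * PI) ^ (2 * S p) * (x ^ 2) ^ S p * Series (fun n => / INR (S n) ^ (2 * S p))) by ring.
      rewrite <- Series_scal_l. apply Series_ext. intros l. unfold r, Rdiv.
      rewrite !Rpow_mult_distr, pow_inv, !Rpow_mult_distr, <- !pow_mult, !Rinv_mult. ring. }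
    assert (E4 : ex_series (fun p => zeta_even_coef (S p) * (x ^ 2) ^ S p)).
    { refine (ex_series_ext_R _ _ _ E2). intros p. apply S2. }
    assert (E5 : ex_series (fun p => zeta_even_coef p * (x ^ 2) ^ p)).
    { now apply (ex_series_incr_1 (fun p => zeta_even_coef p * (x ^ 2) ^ p)). }
    split. now apply ex_pseries_R.
    unfold PSeries. rewrite Series_incr_1 by exact E5.
    rewrite <- (Series_ext _ _ S2), <- E3, (Series_ext _ _ S1), Series_scal_l.
    rewrite (is_series_unique _ _ (coth2R_expansion x ltac:(lra))). simpl. field. lra.
Qed.

(** The even part depends on [x^2] alone, so for negative [x] it is evaluated at [Rabs x]. *)
Lemma todd_pseries (x : R) : 0 < Rabs x < 1 ->
  PSeries todd_coef x = x * exp x / (exp x - 1).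
Proof.
  intros Hx.
  assert (Ev : forall t, (fun n => todd_coef (2 * n)) t = zeta_even_coef t) by apply todd_coef_even.
  destruct (zeta_even_pseries (Rabs x) Hx) as [X1 X2].
  rewrite pow2_abs in X1, X2.
  assert (Ho : is_pseries (fun n => todd_coef (2 * n + 1)) (x ^ 2) (/ 2)).
  { apply is_pseries_R. refine (is_lim_seq_ext (fun _ => / 2) _ (/ 2) _ (is_lim_seq_const _)).
    intros n. rewrite sum_n_Reals. induction n.
    - cbn [sum_f_R0]. rewrite todd_coef_odd. simpl. ring.
    - rewrite tech5, <- IHn, todd_coef_odd. simpl. ring. }
  rewrite PSeries_odd_even.
  - rewrite (PSeries_ext _ _ _ Ev), X2, (is_pseries_unique _ _ _ Ho). unfold coth2R.
    destruct (Rle_or_lt 0 x) as [P|P].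
    + rewrite Rabs_pos_eq in * by auto. assert (H := exp_sub_1_pos x ltac:(lra)). field. lra.
    + rewrite Rabs_left in * by auto. assert (H := exp_sub_1_pos (- x) ltac:(lra)).
      rewrite exp_Ropp in *. assert (Q := exp_pos x).
      assert (0 < 1 - exp x).
      { replace (1 - exp x) with ((/ exp x - 1) * exp x) by (field; lra). now apply Rmult_lt_0_compat. }
      field. lra.
  - apply ex_pseries_R. apply ex_pseries_R in X1. refine (ex_series_ext_R _ _ _ X1).
    intros n. now rewrite Ev.
  - exists (/ 2). exact Ho.
Qed.

Lemma inv_fact_bound (n : nat) : Rabs (/ INR (fact n)) <= 1.
Proof.
  assert (H := lt_O_fact n). apply le_INR in H. simpl in H.
  rewrite Rabs_pos_eq by (apply Rlt_le, Rinv_0_lt_compat; lra).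
  rewrite <- Rinv_1. apply Rinv_le_contravar; lra.
Qed.

(** Compares coefficients in [(x e^x / (e^x - 1)) ((e^x - 1) / x) = e^x], the left side being a
    Cauchy product. *)
Lemma todd_recursion (n : nat) :
  sum_f_R0 (fun k => todd_coef k * / INR (fact (S (n - k)))) n = / INR (fact n).
Proof.
  set (E := fun n => / INR (fact (S n))).
  assert (HE : forall n, Rabs (E n) <= 1) by (intros; apply inv_fact_bound).
  assert (HF := inv_fact_bound).
  assert (Hc := todd_coef_bound).
  assert (PE : forall x, x * PSeries E x = exp x - 1).
  { intros x. assert (H := is_exp_Reals x).
    assert (G := PSeries_decr_1 _ x (ex_intro _ _ H)).
    rewrite (is_pseries_unique _ _ _ H) in G. change (PS_decr_1 (fun n => / INR (Factorial.fact n))) with E in G.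
    simpl in G. rewrite G. field. }
  assert (L0 : forall a M, (forall n, Rabs (a n) <= M) -> Rbar_lt 0 (CV_radius a)).
  { intros a M H. rewrite <- Rabs_R0. apply CV_radius_inside_1 with M; auto. rewrite Rabs_R0; lra. }
  assert (PM : forall x, Rabs x < 1 -> PSeries (PS_mult todd_coef E) x = exp x).
  { intros x Hx. rewrite PSeries_mult by (eapply CV_radius_inside_1; eauto).
    (* At [0] the quotient in [todd_pseries] would be [0] by the convention on division, so the
       constant terms are compared directly. *)
    destruct (Req_dec x 0) as [->|H0].
    - rewrite !PSeries_0, exp_0. unfold E, todd_coef; simpl. field.
    - rewrite todd_pseries by (split; auto; now apply Rabs_pos_lt).
      assert (exp x - 1 <> 0).
      { intros Z. apply H0. apply exp_inv. rewrite exp_0. lra. }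
      replace (PSeries E x) with ((exp x - 1) / x) by (rewrite <- PE; field; auto). field. auto. }
  change (PS_mult todd_coef E n = (fun n => / INR (fact n)) n).
  apply PSeries_ext_recip.
  (* With radius [0] the terms of the product series at [1/2] could not tend to [0], yet the Cauchy
     product converges there. *)
  - apply Rbar_not_le_lt. intros Q.
    assert (H2 : Rabs (/ 2) < 1) by (rewrite Rabs_pos_eq; lra).
    apply (CV_disk_outside (PS_mult todd_coef E) (/ 2)).
    + apply Rbar_le_lt_trans with (1 := Q). simpl. rewrite Rabs_pos_eq; lra.
    + apply ex_series_lim_0. apply ex_pseries_R. apply ex_pseries_mult; eapply CV_radius_inside_1; eauto.
  - now apply L0 with 1.
  - exists (mkposreal 1 Rlt_0_1). intros x Hx.
    rewrite PM. symmetry. apply is_pseries_unique, is_exp_Reals.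
    change (Rabs (x + - 0) < 1) in Hx. now rewrite Ropp_0, Rplus_0_r in Hx.
Qed.

(** * Bernoulli numbers and Euler's formula for even zeta values *)

Lemma bern_table_le (n k : nat) : (k <= n)%nat -> bern_table n k = bernoulli k.
Proof.
  induction n; intros H.
  - replace k with O by lia. reflexivity.
  - destruct (Nat.eq_dec k (S n)) as [->|D]; auto.
    simpl. destruct (Nat.leb_spec k n); [apply IHn | ]; lia.
Qed.

Lemma bernoulli_recursion (n : nat) :
  sum_f_R0 (fun k => Binomial.C (S n) k * bernoulli k) n = INR (S n).
Proof.
  destruct n.
  - simpl. unfold Binomial.C, bernoulli; simpl. field.
  - rewrite tech5. unfold bernoulli at 2. cbn [bern_table].
    destruct (Nat.leb_spec (S n) n) as [|_]; [lia|].
    rewrite (sum_eq (fun i => Binomial.C (S (S n)) i * bern_table n i)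
                    (fun k => Binomial.C (S (S n)) k * bernoulli k)).
    2:{ intros i Hi. now rewrite bern_table_le. }
    assert (HC : Binomial.C (S (S n)) (S n) = INR (S (S n))).
    { unfold Binomial.C. replace (S (S n) - S n)%nat with 1%nat by lia.
      rewrite (fact_simpl (S n)), mult_INR. simpl (fact 1). simpl (INR 1).
      field. apply INR_fact_neq_0. }
    rewrite HC. field. apply not_0_INR. lia.
Qed.

(** Divided by [(n+1)!], [bernoulli_recursion] becomes [todd_recursion]. The recursion is triangular
    with coefficient [1] at index [n], so strong induction identifies the two sequences. *)
Lemma todd_coef_bernoulli (n : nat) : todd_coef n = bernoulli n / INR (fact n).
Proof.
  induction n as [n IH] using lt_wf_ind.
  assert (H1 := todd_recursion n). assert (H2 := bernoulli_recursion n).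
  assert (H3 : sum_f_R0 (fun k => bernoulli k / INR (fact k) * / INR (fact (S (n - k)))) n = / INR (fact n)).
  { apply Rmult_eq_reg_l with (INR (fact (S n))); [|apply INR_fact_neq_0].
    rewrite scal_sum.
    replace (INR (fact (S n)) * / INR (fact n)) with (INR (S n))
      by (rewrite (fact_simpl n), mult_INR; field; apply INR_fact_neq_0).
    rewrite <- H2. apply sum_eq. intros k Hk. unfold Binomial.C.
    replace (S n - k)%nat with (S (n - k)) by lia.
    field. split; apply INR_fact_neq_0. }
  destruct n.
  - simpl in *. lra.
  - rewrite tech5 in H1, H3. rewrite <- H3 in H1. rewrite Nat.sub_diag in H1. simpl (fact 1) in H1.
    rewrite (sum_eq _ (fun k => bernoulli k / INR (fact k) * / INR (fact (S (S n - k))))) in H1.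
    + apply Rplus_eq_reg_l in H1. simpl (INR 1) in H1. rewrite Rinv_1, !Rmult_1_r in H1. exact H1.
    + intros i Hi. rewrite IH; auto. lia.
Qed.

Lemma zeta_nat_even (p : nat) : (1 <= p)%nat ->
  zeta_nat (2 * p) = (-1) ^ S p * bernoulli (2 * p) * (2 * PI) ^ (2 * p) / (2 * INR (fact (2 * p))).
Proof.
  intros Hp. destruct p; [lia|].
  assert (H := todd_coef_bernoulli (2 * S p)). rewrite todd_coef_even in H. unfold zeta_even_coef in H.
  assert (HP := PI2_3_2). assert (H2 : 0 < (2 * PI) ^ (2 * S p)) by (apply pow_lt; lra).
  assert (HF := INR_fact_neq_0 (2 * S p)).
  set (s := (2 * S p)%nat) in *.
  replace (bernoulli s) with ((-1) ^ p * 2 * zeta_nat s / (2 * PI) ^ s * INR (fact s)).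
  - replace ((-1) ^ S (S p)) with ((-1) ^ p) by (simpl; ring).
    assert (E : (-1) ^ p * (-1) ^ p = 1) by (rewrite <- Rpow_mult_distr; replace (-1 * -1) with 1 by ring; apply pow1).
    transitivity (((-1) ^ p * (-1) ^ p) * zeta_nat s). rewrite E; ring. assert (P0 : (2 * PI) ^ s <> 0) by lra. revert P0. generalize ((2 * PI) ^ s). intros P P0. field. auto.
  - rewrite H. field. auto.
Qed.

Lemma Series_alt_pow (s : nat) : (2 <= s)%nat ->
  Series (fun k => (-1) ^ S k / INR (S k) ^ s) = (2 / 2 ^ s - 1) * zeta_nat s.
Proof.
  intros Hs. unfold Rdiv at 1.
  assert (E : forall n, / INR (S (2 * n + 1)) ^ s = / 2 ^ s * / INR (S n) ^ s).
  { intros n. replace (S (2 * n + 1)) with (2 * S n)%nat by lia. rewrite mult_INR. change (INR 2) with 2.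
    rewrite Rpow_mult_distr. apply Rinv_mult. }
  rewrite (Series_alt (fun k => / INR (S k) ^ s)).
  - unfold zeta_nat. rewrite (Series_ext _ _ E), Series_scal_l. unfold Rdiv. ring.
  - apply ex_series_ext_R with (fun n => / INR (S n) ^ s).
    + intros n. symmetry. now apply Rabs_pos_eq, Rlt_le, inv_pow_le_inv_sq.
    + now apply ex_series_inv_pow.
  - apply ex_series_ext_R with (fun n => / 2 ^ s * / INR (S n) ^ s).
    + intros n. now rewrite E.
    + now apply ex_series_scal_R, ex_series_inv_pow.
Qed.

(** * Operations on complex series *)

Lemma is_Cseries_ext (a b : nat -> C) (l : C) : (forall n, a n = b n) -> is_Cseries a l -> is_Cseries b l.
Proof.
  intros H [H1 H2]; split.
  - refine (is_series_ext _ _ _ _ H1); intros n; now rewrite H.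
  - refine (is_series_ext _ _ _ _ H2); intros n; now rewrite H.
Qed.

Lemma is_Cseries_plus (a b : nat -> C) (la lb : C) :
  is_Cseries a la -> is_Cseries b lb -> is_Cseries (fun n => (a n + b n)%C) (la + lb)%C.
Proof.
  intros [H1 H2] [H3 H4]; split; simpl.
  - exact (is_series_plus (V := R_NormedModule) _ _ _ _ H1 H3).
  - exact (is_series_plus (V := R_NormedModule) _ _ _ _ H2 H4).
Qed.

Lemma is_series_zero : is_series (fun _ : nat => 0) 0.
Proof.
  refine (is_lim_seq_ext (fun _ => 0) _ 0 _ (is_lim_seq_const 0)).
  intros n. rewrite sum_n_Reals. induction n; simpl; lra.
Qed.

Lemma is_Cseries_scal (c : R) (a : nat -> C) (l : C) :
  is_Cseries a l -> is_Cseries (fun n => (c * a n)%C) (c * l)%C.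
Proof.
  intros [H1 H2]; split.
  - apply (is_series_ext (V := R_NormedModule)) with (fun n => c * fst (a n)).
    intros n; simpl; ring. replace (fst (c * l)%C) with (c * fst l) by (simpl; ring).
    exact (is_series_scal (V := R_NormedModule) c _ _ H1).
  - apply (is_series_ext (V := R_NormedModule)) with (fun n => c * snd (a n)).
    intros n; simpl; ring. replace (snd (c * l)%C) with (c * snd l) by (simpl; ring).
    exact (is_series_scal (V := R_NormedModule) c _ _ H2).
Qed.

Lemma is_Cseries_Csum (a : nat -> nat -> C) (l : nat -> C) (n : nat) :
  (forall i, (i < n)%nat -> is_Cseries (a i) (l i)) ->
  is_Cseries (fun k => Csum (fun i => a i k) n) (Csum l n).
Proof.
  induction n; intros H; simpl.
  - split; apply is_series_zero.
  - apply is_Cseries_plus; auto.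
Qed.

Lemma is_Cseries_RtoC (a : nat -> R) (l : C) :
  is_Cseries (fun k => RtoC (a k)) l -> l = RtoC (Series a) /\ ex_series a.
Proof.
  intros [H1 H2]. simpl in H1, H2. split; [|now exists (fst l)].
  destruct l as [x y]; simpl in *. unfold RtoC. f_equal.
  - symmetry. now apply is_series_unique.
  - rewrite <- (is_series_unique _ _ H2). apply is_series_unique, is_series_zero.
Qed.

Lemma ex_Cseries_dom (a : nat -> C) (b : nat -> R) :
  (forall n, Cmod (a n) <= b n) -> ex_series b -> is_Cseries a (CSeries a).
Proof.
  intros H Hb; split; apply Series_correct, ex_series_dom with b; auto; intros n;
    (eapply Rle_trans; [|apply H]). apply Rabs_fst_le. apply Rabs_snd_le.
Qed.

(** * Sums over roots of unity *)

Lemma Cexp_imag_pow (t : R) (n : nat) : (Cexp (0, t) ^ n)%C = Cexp (0, INR n * t).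
Proof.
  induction n.
  - simpl. rewrite Rmult_0_l. symmetry. apply Cexp_0.
  - simpl Cpow. rewrite IHn, <- Cexp_add. f_equal. unfold Cplus; cbn [fst snd].
    rewrite S_INR. f_equal; ring.
Qed.

Lemma Cexp_PI_nat (n : nat) : Cexp (0, PI * INR n) = RtoC ((-1) ^ n).
Proof.
  rewrite Rmult_comm, <- Cexp_imag_pow, Cexp_iPI, RtoC_pow. f_equal. now rewrite <- RtoC_opp.
Qed.

Lemma pow_m1_sqr (n : nat) : (-1) ^ n * (-1) ^ n = 1.
Proof. rewrite <- Rpow_mult_distr. replace (-1 * -1) with 1 by ring. apply pow1. Qed.

Lemma powerRZ_m1_sub (i h : nat) : powerRZ (-1) (Z.of_nat i - Z.of_nat h) = (-1) ^ i * (-1) ^ h.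
Proof.
  unfold Z.sub. rewrite powerRZ_add by lra. rewrite powerRZ_neg' , <- !pow_powerRZ.
  assert (H := pow_m1_sqr h). f_equal.
  apply Rmult_eq_reg_l with ((-1) ^ h). rewrite H. apply Rinv_r. all: intros Z; rewrite Z in H; lra.
Qed.

Lemma Csum_geom (q : C) (n : nat) : ((q - 1) * Csum (fun i => q ^ i) n = q ^ n - 1)%C.
Proof. induction n; simpl. ring. rewrite Cmult_plus_distr_l, IHn. ring. Qed.

Lemma Cexp_imag_neq_1 (t : R) : 0 < t < 2 * PI -> Cexp (0, t) <> 1%C.
Proof.
  intros Ht H. assert (E : cos t = 1).
  { apply (f_equal fst) in H. simpl in H. rewrite exp_0, Rmult_1_l in H. exact H. }
  replace t with (2 * (t / 2)) in E by field. rewrite cos_2a_sin in E.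
  assert (0 < sin (t / 2)) by (apply sin_gt_0; lra). nra.
Qed.

(* For [N = 2 h + 1] and [0 <= i < N], put [j = i - h]: [omega] is [e^(i pi j / N)], and the
   [N]-th roots of unity are its squares [omega2]. *)
Definition omega (h i : nat) : C := Cexp (0, PI * IZR (Z.of_nat i - Z.of_nat h) / INR (2 * h + 1)).
Definition omega2 (h i : nat) : C := (omega h i * omega h i)%C.

Lemma INR_odd_pos (h : nat) : 0 < INR (2 * h + 1).
Proof. apply lt_0_INR. lia. Qed.

Lemma omega2_Cexp (h i : nat) :
  omega2 h i = Cexp (0, 2 * PI * IZR (Z.of_nat i - Z.of_nat h) / INR (2 * h + 1)).
Proof.
  unfold omega2, omega. rewrite <- Cexp_add. f_equal. unfold Cplus; cbn [fst snd]. f_equal. ring.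
  assert (H := INR_odd_pos h). field. lra.
Qed.

(** [(-1)^j = e^(i pi j)], so the product is [e^(i pi j (N+1) / N)], the power [(N+1)/2] of the root
    of unity. As [N] is odd, this exponent is the integer [h + 1]. *)
Lemma sign_mul_omega (h i : nat) :
  (RtoC (powerRZ (-1) (Z.of_nat i - Z.of_nat h)) * omega h i)%C = (omega2 h i ^ S h)%C.
Proof.
  rewrite powerRZ_m1_sub, RtoC_mult, omega2_Cexp, Cexp_imag_pow, <- !Cexp_PI_nat.
  assert (E : Cexp (0, PI * INR h) = Cexp (0, - (PI * INR h))%R).
  { assert (H : (Cexp (0, PI * INR h)%R * Cexp (0, PI * INR h)%R)%C = 1%C).
    { rewrite !Cexp_PI_nat, <- RtoC_mult. f_equal. apply pow_m1_sqr. }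
    replace (0, - (PI * INR h))%R with (- (0, PI * INR h)%R)%C by (unfold Copp; cbn [fst snd]; f_equal; ring).
    rewrite Cexp_opp. rewrite <- (Cmult_1_l (/ _)), <- H. field. apply Cexp_neq_0. }
  rewrite E. unfold omega. rewrite <- !Cexp_add. f_equal. unfold Cplus; cbn [fst snd]. f_equal. ring.
  rewrite minus_IZR, <- !INR_IZR_INZ.
  assert (H := INR_odd_pos h). rewrite S_INR. rewrite plus_INR, mult_INR in *. simpl (INR 2) in *. simpl (INR 1) in *.
  field. lra.
Qed.

Lemma omega_neq_0 (h i : nat) : omega h i <> 0%C.
Proof. apply Cexp_neq_0. Qed.

Lemma sign_div_omega (h i : nat) :
  (RtoC (powerRZ (-1) (Z.of_nat i - Z.of_nat h)) / omega h i)%C = (omega2 h i ^ h)%C.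
Proof.
  assert (H := omega_neq_0 h i).
  replace (omega2 h i ^ h)%C with (omega2 h i ^ S h / omega2 h i)%C.
  - rewrite <- sign_mul_omega. unfold omega2. field. auto.
  - simpl Cpow. field. unfold omega2. now apply Cmult_neq_0.
Qed.

Lemma omega2_pow_N (h i : nat) : (omega2 h i ^ (2 * h + 1))%C = 1%C.
Proof.
  rewrite omega2_Cexp, Cexp_imag_pow.
  replace (INR (2 * h + 1) * (2 * PI * IZR (Z.of_nat i - Z.of_nat h) / INR (2 * h + 1)))
    with (PI * INR (2 * i) + - (PI * INR (2 * h))).
  - replace (0, PI * INR (2 * i) + - (PI * INR (2 * h)))
      with ((0, PI * INR (2 * i))%R + - (0, PI * INR (2 * h))%R)%C.
    + rewrite Cexp_add, Cexp_opp, !Cexp_PI_nat, !pow_1_even. field.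
    + unfold Cplus, Copp; cbn [fst snd]. f_equal. ring.
  - rewrite minus_IZR, <- !INR_IZR_INZ, !(mult_INR 2). change (INR 2) with 2.
    assert (H := INR_odd_pos h). field. lra.
Qed.

(** A geometric sum whose ratio [q] satisfies [q^N = 1] and, since [0 < p < N], [q <> 1]. The factor
    [q0] accounts for [j] starting at [- h]. *)
Lemma Csum_omega2_pow (h p : nat) : (1 <= p <= 2 * h)%nat ->
  Csum (fun i => omega2 h i ^ p)%C (2 * h + 1) = 0%C.
Proof.
  intros Hp. set (q := Cexp (0, INR p * (2 * PI / INR (2 * h + 1)))).
  set (q0 := Cexp (0, - (INR p * (2 * PI * INR h / INR (2 * h + 1))))).
  assert (HN := INR_odd_pos h).
  rewrite (Csum_ext _ (fun i => (q0 * q ^ i)%C)).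
  - rewrite Csum_scal.
    assert (Hq : (q - 1)%C <> 0%C).
    { intros Z. apply (Cexp_imag_neq_1 (INR p * (2 * PI / INR (2 * h + 1)))).
      - assert (Hpi := PI_RGT_0).
        assert (0 < INR p) by (apply lt_0_INR; lia). assert (INR p < INR (2 * h + 1)) by (apply lt_INR; lia).
        replace (INR p * (2 * PI / INR (2 * h + 1))) with (2 * PI * (INR p / INR (2 * h + 1))) by (field; lra).
        assert (0 < INR p / INR (2 * h + 1)) by (apply Rdiv_lt_0_compat; lra).
        assert (INR p / INR (2 * h + 1) < 1).
        { apply Rmult_lt_reg_r with (INR (2 * h + 1)); auto. unfold Rdiv. rewrite Rmult_assoc, Rinv_l; lra. }
        nra.
      - fold q. transitivity (q - 1 + 1)%C. ring. rewrite Z. ring. }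
    assert (G := Csum_geom q (2 * h + 1)).
    assert (Q : (q ^ (2 * h + 1))%C = 1%C).
    { unfold q. rewrite Cexp_imag_pow.
      replace (INR (2 * h + 1) * (INR p * (2 * PI / INR (2 * h + 1)))) with (PI * INR (2 * p))
        by (rewrite (mult_INR 2); change (INR 2) with 2; field; lra).
      now rewrite Cexp_PI_nat, pow_1_even. }
    rewrite Q in G. replace (Csum (Cpow q) (2 * h + 1)) with (RtoC 0). ring.
    transitivity ((1 - 1) / (q - 1))%C. field; auto. rewrite <- G. change (fun i => (q ^ i)%C) with (Cpow q). field. auto.
  - intros i _. unfold q, q0. rewrite omega2_Cexp, !Cexp_imag_pow, <- Cexp_add. f_equal.
    unfold Cplus; cbn [fst snd]. rewrite minus_IZR, <- !INR_IZR_INZ. f_equal; field; lra.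
Qed.

Lemma Csum_const_1 (n : nat) : Csum (fun _ => 1%C) n = RtoC (INR n).
Proof. induction n. reflexivity. rewrite S_INR, RtoC_plus, <- IHn. reflexivity. Qed.

(** [N] is odd, so [(- c)^N] is negative and [- c] is no [N]-th root of unity. *)
Lemma omega2_add_neq_0 (h i : nat) (c : R) : 0 < c -> (omega2 h i + c)%C <> 0%C.
Proof.
  intros Hc Z. assert (H := omega2_pow_N h i).
  replace (omega2 h i) with (RtoC (- c)) in H.
  - rewrite <- RtoC_pow in H. apply RtoC_inj in H.
    replace (- c) with (-1 * c) in H by ring. rewrite Rpow_mult_distr, Nat.add_1_r, pow_1_odd in H.
    assert (0 < c ^ S (2 * h)) by now apply pow_lt. lra.
  - rewrite RtoC_opp. transitivity (omega2 h i + c + - c)%C. rewrite Z. ring. ring.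
Qed.

(* The sums [T p] of [z^p / (z + c)] over the roots of unity satisfy [T (p+1) + c T p = 0] for
   [0 < p < N], [T 1 + c T 0 = N] and [T N = T 0]. *)
Lemma Csum_omega2_partial_fraction (h : nat) (c : R) : 0 < c ->
  Csum (fun i => omega2 h i ^ S h / (omega2 h i + c))%C (2 * h + 1) =
  RtoC (INR (2 * h + 1) * (- c) ^ h / (1 + c ^ (2 * h + 1))).
Proof.
  intros Hc. set (T := fun p => Csum (fun i => omega2 h i ^ p / (omega2 h i + c))%C (2 * h + 1)).
  assert (R1 : forall p, (T (S p) + c * T p)%C = Csum (fun i => omega2 h i ^ p)%C (2 * h + 1)).
  { intros p. unfold T. rewrite <- Csum_scal, <- Csum_plus. apply Csum_ext. intros i _.
    simpl Cpow. field. now apply omega2_add_neq_0. }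
  assert (R2 : forall d, (d <= 2 * h)%nat -> T (S d) = (RtoC ((- c) ^ d) * T 1%nat)%C).
  { induction d; intros Hd. simpl pow. ring.
    assert (E := R1 (S d)). rewrite Csum_omega2_pow in E by lia. rewrite IHd in E by lia.
    transitivity (0 - c * (RtoC ((- c) ^ d) * T 1%nat))%C. rewrite <- E. ring.
    simpl pow. rewrite RtoC_mult, RtoC_opp. ring. }
  assert (R3 : T (S (2 * h)) = T O).
  { unfold T. apply Csum_ext. intros i _. rewrite <- Nat.add_1_r, omega2_pow_N. reflexivity. }
  assert (R4 := R1 O). change (Csum (fun i => (omega2 h i ^ 0)%C) (2 * h + 1)) with (Csum (fun _ => 1%C) (2 * h + 1)) in R4.
  rewrite Csum_const_1, <- R3, (R2 (2 * h)%nat) in R4 by lia.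
  assert (E2 : (- c) ^ (2 * h) = c ^ (2 * h)).
  { rewrite !pow_mult. f_equal. ring. }
  assert (HD : 0 < 1 + c ^ (2 * h + 1)) by (assert (0 < c ^ (2 * h + 1)) by (now apply pow_lt); lra).
  assert (T1 : T 1%nat = RtoC (INR (2 * h + 1) / (1 + c ^ (2 * h + 1)))).
  { rewrite RtoC_div by lra. rewrite <- R4, E2. rewrite RtoC_plus.
    rewrite (pow_add c (2 * h) 1), RtoC_mult. simpl (c ^ 1). rewrite Rmult_1_r.
    assert (NZ := RtoC_neq_0 _ (Rgt_not_eq _ _ HD)). rewrite RtoC_plus, (pow_add c (2 * h) 1), RtoC_mult in NZ.
    simpl (c ^ 1) in NZ. rewrite Rmult_1_r in NZ. field. exact NZ. }
  change (T (S h) = RtoC (INR (2 * h + 1) * (- c) ^ h / (1 + c ^ (2 * h + 1)))).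
  rewrite R2, T1, <- RtoC_mult by lia. f_equal. field. lra.
Qed.

(** * Lattice sums *)

(* [Q_l] of the header, with [l + 1] and [k + 1] for [l] and [k] here and below. *)
Definition dilate (tau : R) (N l : nat) : R := tau * INR (S l) ^ N.

(** [a] and [b] count the factors [Q_l^(-2)] and [k^(-2)]: the left side of the theorem leads to
    [(m, 0)], the right side to [(0, m)]. *)
Definition lattice_term (tau : R) (N a b l k : nat) : R :=
  (-1) ^ S k * (dilate tau N l / INR (S l)) / dilate tau N l ^ (2 * a) / INR (S k) ^ (2 * b)
  / (dilate tau N l ^ 2 + INR (S k) ^ 2).

Definition lattice_sum (tau : R) (N a b : nat) : R :=
  Series (fun l => Series (fun k => lattice_term tau N a b l k)).

(** For [b >= 1] this is minus the Dirichlet eta function at [2 b], since the first sign is [-1]. *)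
Definition eta_even (b : nat) : R := Series (fun k => (-1) ^ S k / INR (S k) ^ (2 * b)).

Lemma dilate_pos (tau : R) (N l : nat) : 0 < tau -> 0 < dilate tau N l.
Proof. intros H. apply Rmult_lt_0_compat; auto. apply pow_lt, INR_S_pos. Qed.

Lemma dilate_quot (tau : R) (N a l : nat) : 0 < tau -> (1 <= N)%nat ->
  dilate tau N l / INR (S l) / dilate tau N l ^ (2 * S a) =
  tau / tau ^ (2 * S a) * / INR (S l) ^ (2 * N * S a + 1 - N).
Proof.
  intros Ht HN. unfold dilate. assert (H := INR_S_pos l). set (x := INR (S l)) in *.
  assert (E : (x ^ N) ^ (2 * S a) * x = x ^ N * x ^ (2 * N * S a + 1 - N)).
  { rewrite <- pow_mult, <- pow_add.
    replace (N + (2 * N * S a + 1 - N))%nat with (S (N * (2 * S a))) by nia. simpl. ring. }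
  rewrite Rpow_mult_distr.
  assert (0 < x ^ N) by now apply pow_lt. assert (0 < x ^ (2 * N * S a + 1 - N)) by now apply pow_lt.
  assert (0 < tau ^ (2 * S a)) by now apply pow_lt. assert (0 < (x ^ N) ^ (2 * S a)) by now apply pow_lt.
  revert E H0 H1 H2 H3. generalize (x ^ N) (x ^ (2 * N * S a + 1 - N)) (tau ^ (2 * S a)).
  intros u v t. generalize (u ^ (2 * S a)). intros y E Hu Hv Hty Hy.
  replace (tau * u / x / (t * y)) with (tau * u / (t * (y * x))) by (field; lra).
  rewrite E. field. lra.
Qed.

(** If [a >= 1], the powers of [Q_l] already decay like [l^(-2)], and [Q_l^2 + k^2 >= k^2] gives the
    decay in [k]. If [a = 0], then [k^(-2 b)] provides the latter and [Q_l^2 + k^2 >= Q_l^2] the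
    former. *)
Lemma lattice_term_bound (tau : R) (N a b : nat) : 0 < tau -> (1 <= N)%nat -> (1 <= a + b)%nat ->
  exists C, 0 <= C /\ forall l k, Rabs (lattice_term tau N a b l k) <= C * / INR (S l) ^ 2 * / INR (S k) ^ 2.
Proof.
  intros Ht HN Hab.
  assert (AUX : forall l k, Rabs (lattice_term tau N a b l k) =
     dilate tau N l / INR (S l) / dilate tau N l ^ (2 * a) * / INR (S k) ^ (2 * b) * / (dilate tau N l ^ 2 + INR (S k) ^ 2)).
  { intros l k. assert (H1 := dilate_pos tau N l Ht). assert (H2 := INR_S_pos l). assert (H3 := INR_S_pos k).
    unfold lattice_term, Rdiv. rewrite !Rabs_mult, pow_1_abs, !Rabs_inv.
    rewrite !Rabs_pos_eq; try (apply pow_le); try apply Rlt_le; auto. ring.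
    apply Rplus_lt_0_compat; now apply pow_lt. }
  assert (P1 : forall l k, 0 < / (dilate tau N l ^ 2 + INR (S k) ^ 2) <= / INR (S k) ^ 2).
  { intros l k. assert (H1 := dilate_pos tau N l Ht). assert (H3 := INR_S_pos k).
    assert (0 < dilate tau N l ^ 2) by now apply pow_lt. assert (0 < INR (S k) ^ 2) by now apply pow_lt.
    split. apply Rinv_0_lt_compat; lra. apply Rinv_le_contravar; lra. }
  destruct a as [|a].
  - exists (/ tau). split. apply Rlt_le, Rinv_0_lt_compat; auto.
    intros l k. rewrite AUX.
    assert (H1 := dilate_pos tau N l Ht). assert (H2 := INR_S_pos l). assert (H3 := INR_S_pos k).
    assert (P2 : / (dilate tau N l ^ 2 + INR (S k) ^ 2) <= / dilate tau N l ^ 2).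
    { assert (0 < dilate tau N l ^ 2) by now apply pow_lt. assert (0 < INR (S k) ^ 2) by now apply pow_lt.
      apply Rinv_le_contravar; lra. }
    destruct (inv_pow_le_inv_sq (2 * b) k ltac:(lia)) as [B1 B2].
    destruct (inv_pow_le_inv_sq (N + 1) l ltac:(lia)) as [B3 B4].
    apply Rle_trans with (dilate tau N l / INR (S l) / dilate tau N l ^ (2 * 0) * / INR (S k) ^ 2 * / dilate tau N l ^ 2).
    + assert (0 < dilate tau N l / INR (S l) / dilate tau N l ^ (2 * 0)).
      { simpl (_ ^ (2 * 0)). rewrite Rdiv_1_r. now apply Rdiv_lt_0_compat. }
      apply Rmult_le_compat; auto. apply Rmult_le_pos; lra. apply Rlt_le, P1.
      apply Rmult_le_compat_l; lra.
    + replace (dilate tau N l / INR (S l) / dilate tau N l ^ (2 * 0) * / INR (S k) ^ 2 * / dilate tau N l ^ 2)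
        with (/ tau * / INR (S l) ^ (N + 1) * / INR (S k) ^ 2).
      * apply Rmult_le_compat_r. apply Rlt_le, Rinv_0_lt_compat, pow_lt; auto.
        apply Rmult_le_compat_l; auto. apply Rlt_le, Rinv_0_lt_compat; auto.
      * unfold dilate. rewrite pow_add. simpl (_ ^ (2 * 0)). rewrite pow_1.
        assert (0 < INR (S l) ^ N) by now apply pow_lt. field. repeat split; apply Rgt_not_eq; auto.
  - exists (tau / tau ^ (2 * S a)). split.
    apply Rlt_le, Rdiv_lt_0_compat; auto. now apply pow_lt.
    intros l k. rewrite AUX, dilate_quot by auto.
    destruct (inv_pow_le_inv_sq (2 * N * S a + 1 - N) l ltac:(nia)) as [B1 B2].
    assert (T : 0 < tau / tau ^ (2 * S a)) by (apply Rdiv_lt_0_compat; auto; now apply pow_lt).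
    assert (B3 : 0 < / INR (S k) ^ (2 * b) <= 1).
    { split. apply Rinv_0_lt_compat, pow_lt, INR_S_pos. rewrite <- Rinv_1. apply Rinv_le_contravar. lra.
      apply pow_R1_Rle, INR_S_ge_1. }
    destruct (P1 l k) as [P2 P3].
    apply Rmult_le_compat; try lra.
    + apply Rmult_le_pos; [|lra]. apply Rmult_le_pos; lra.
    + rewrite <- (Rmult_1_r (tau / tau ^ (2 * S a) * / INR (S l) ^ 2)).
      apply Rmult_le_compat; try lra. apply Rmult_le_pos; lra. apply Rmult_le_compat_l; lra.
Qed.

Lemma lattice_sum_swap (tau : R) (N a b : nat) : 0 < tau -> (1 <= N)%nat -> (1 <= a + b)%nat ->
  (forall l, ex_series (fun k => lattice_term tau N a b l k)) /\
  ex_series (fun l => Series (fun k => lattice_term tau N a b l k)) /\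
  lattice_sum tau N a b = Series (fun k => Series (fun l => lattice_term tau N a b l k)).
Proof.
  intros Ht HN Hab. destruct (lattice_term_bound tau N a b Ht HN Hab) as [C [HC HB]].
  assert (P : forall n, 0 <= / INR (S n) ^ 2) by (intros; apply Rlt_le, Rinv_0_lt_compat, pow_lt, INR_S_pos).
  split.
  - intros l. apply ex_series_dom with (1 := HB l). apply ex_series_scal_R, ex_series_inv_sq.
  - destruct (Series_swap (lattice_term tau N a b) (fun l => C * / INR (S l) ^ 2) (fun k => / INR (S k) ^ 2)) as [H1 [_ H2]]; auto.
    apply ex_series_scal_R, ex_series_inv_sq. apply ex_series_inv_sq.
    intros n. now apply Rmult_le_pos.
Qed.

(* [1 / (Q^2 k^2) = (1 / Q^2 + 1 / k^2) / (Q^2 + k^2)]; the product of the two denominators separates. *)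
Lemma lattice_sum_step (tau : R) (N a b : nat) : 0 < tau -> (1 <= N)%nat ->
  lattice_sum tau N (S a) b + lattice_sum tau N a (S b) =
  tau / tau ^ (2 * S a) * zeta_nat (2 * N * S a + 1 - N) * eta_even (S b).
Proof.
  intros Ht HN.
  destruct (lattice_sum_swap tau N (S a) b Ht HN ltac:(lia)) as [A1 [A2 _]].
  destruct (lattice_sum_swap tau N a (S b) Ht HN ltac:(lia)) as [B1 [B2 _]].
  unfold lattice_sum. rewrite <- Series_plus by auto.
  rewrite (Series_ext _ (fun l => tau / tau ^ (2 * S a) * eta_even (S b) * / INR (S l) ^ (2 * N * S a + 1 - N))).
  - rewrite Series_scal_l. unfold zeta_nat. ring.
  - intros l. rewrite <- Series_plus by auto.
    transitivity (dilate tau N l / INR (S l) / dilate tau N l ^ (2 * S a) * eta_even (S b)).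
    + unfold eta_even. rewrite <- Series_scal_l. apply Series_ext. intros k.
      assert (H1 := dilate_pos tau N l Ht). assert (H2 := INR_S_pos l). assert (H3 := INR_S_pos k).
      unfold lattice_term. set (q := dilate tau N l) in *. set (x := INR (S k)) in *. set (y := INR (S l)) in *.
      replace (2 * S a)%nat with (2 * a + 2)%nat by lia. replace (2 * S b)%nat with (2 * b + 2)%nat by lia.
      rewrite !pow_add.
      assert (0 < q ^ (2 * a)) by now apply pow_lt. assert (0 < x ^ (2 * b)) by now apply pow_lt.
      revert H H0. generalize (q ^ (2 * a)) (x ^ (2 * b)) ((-1) ^ S k). intros u v s Hu Hv.
      field. repeat split; apply Rgt_not_eq; auto. nra.
    + rewrite dilate_quot by auto. ring.
Qed.

(** The summand [b] is the cost of the step from [(m + 1 - b, b)] to [(m - b, b + 1)]. It will be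
    matched with the Bernoulli summand [j = b + 1]. *)
Lemma lattice_sum_telescope (tau : R) (N m : nat) : 0 < tau -> (1 <= N)%nat ->
  lattice_sum tau N (S m) 0 = (-1) ^ S m * lattice_sum tau N 0 (S m) +
  sum_f_R0 (fun b => (-1) ^ b * (tau / tau ^ (2 * S (m - b)) * zeta_nat (2 * N * S (m - b) + 1 - N) * eta_even (S b))) m.
Proof.
  intros Ht HN.
  assert (H : forall b, (b <= m)%nat ->
    lattice_sum tau N (S m) 0 = (-1) ^ S b * lattice_sum tau N (m - b) (S b) +
    sum_f_R0 (fun b => (-1) ^ b * (tau / tau ^ (2 * S (m - b)) * zeta_nat (2 * N * S (m - b) + 1 - N) * eta_even (S b))) b).
  { induction b; intros Hb.
    - cbn [sum_f_R0]. rewrite Nat.sub_0_r, <- lattice_sum_step by auto. simpl pow. ring.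
    - rewrite tech5, IHb by lia. rewrite <- (lattice_sum_step tau N (m - S b) (S b)) by auto.
      replace (S (m - S b)) with (m - b)%nat by lia. simpl pow. ring. }
  rewrite (H m (le_n m)), Nat.sub_diag. reflexivity.
Qed.

(** * Root-of-unity sums of hyperbolic cotangents *)

(** [|j| <= h < N / 2] keeps the angle [pi j / N] strictly between [- pi / 2] and [pi / 2]. Thus
    [coth2_expansion] applies at every [w omega] with [w > 0]. *)
Lemma fst_omega_pos (h i : nat) : (i < 2 * h + 1)%nat -> 0 < fst (omega h i).
Proof.
  intros Hi. unfold omega, Cexp; cbn [fst snd]. rewrite exp_0, Rmult_1_l.
  assert (HN := INR_odd_pos h). assert (HP := PI_RGT_0).
  assert (HJ : - INR (2 * h + 1) / 2 < IZR (Z.of_nat i - Z.of_nat h) < INR (2 * h + 1) / 2).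
  { rewrite minus_IZR, <- !INR_IZR_INZ. assert (H : INR i <= INR (2 * h)) by (apply le_INR; lia).
    assert (0 <= INR i) by apply pos_INR.
    rewrite plus_INR, mult_INR in *. simpl (INR 2) in *. simpl (INR 1) in *. lra. }
  set (n := INR (2 * h + 1)) in *. set (j := IZR (Z.of_nat i - Z.of_nat h)) in *.
  replace (PI * j / n) with (PI * (j / n)) by (field; lra).
  assert (- (1 / 2) < j / n < 1 / 2).
  { assert (E : j / n * n = j) by (field; lra). split; apply Rmult_lt_reg_r with n; auto; rewrite E; lra. }
  apply cos_gt_0; nra.
Qed.

Lemma fst_scal_omega_pos (h i : nat) (w : R) : (i < 2 * h + 1)%nat -> 0 < w -> 0 < fst (w * omega h i)%C.
Proof.
  intros Hi Hw. assert (H := fst_omega_pos h i Hi). destruct (omega h i). simpl in *.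
  rewrite Rmult_0_l, Rminus_0_r. now apply Rmult_lt_0_compat.
Qed.

(** Taking [w^2] out of the denominators leaves [omega2 + c] with [c = (r / w)^2], and the signed
    [omega] in the numerator is [omega2^(h+1)]: this is [Csum_omega2_partial_fraction]. *)
Lemma Csum_coth2_term (h : nat) (w r : R) : 0 < w -> 0 < r ->
  Csum (fun i => RtoC (powerRZ (-1) (Z.of_nat i - Z.of_nat h)) *
     (4 * (w * omega h i) / (w * omega h i * (w * omega h i) + RtoC (r ^ 2))))%C (2 * h + 1) =
  RtoC ((-1) ^ h * (4 * INR (2 * h + 1) * r ^ (2 * h) * w ^ (2 * h + 1) / (w ^ (2 * (2 * h + 1)) + r ^ (2 * (2 * h + 1))))).
Proof.
  intros Hw Hr. set (c := (r / w) ^ 2).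
  assert (Hc : 0 < c) by (apply pow_lt, Rdiv_lt_0_compat; auto).
  rewrite (Csum_ext _ (fun i => RtoC (4 / w) * (omega2 h i ^ S h / (omega2 h i + c)))%C).
  - rewrite Csum_scal, Csum_omega2_partial_fraction, <- RtoC_mult by auto. f_equal. unfold c.
    replace (- (r / w) ^ 2) with (-1 * (r / w) ^ 2) by ring.
    rewrite Rpow_mult_distr, <- !pow_mult. unfold Rdiv. rewrite !Rpow_mult_distr, !pow_inv.
    assert (E : w ^ (2 * (2 * h + 1)) = w * w ^ (2 * h) * w ^ (2 * h + 1)).
    { rewrite <- (pow_1 w) at 2. rewrite <- !pow_add. f_equal. lia. }
    assert (W1 : 0 < w ^ (2 * h)) by now apply pow_lt.
    assert (W2 : 0 < w ^ (2 * h + 1)) by now apply pow_lt.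
    assert (R2 : 0 < r ^ (2 * (2 * h + 1))) by now apply pow_lt.
    rewrite E. revert W1 W2 R2.
    generalize (w ^ (2 * h)) (w ^ (2 * h + 1)) (r ^ (2 * (2 * h + 1))) (r ^ (2 * h)) ((-1) ^ h) (INR (2 * h + 1)).
    intros u v t s e n Hu Hv Ht.
    assert (0 < w * u * v) by (repeat apply Rmult_lt_0_compat; auto).
    field. repeat split; apply Rgt_not_eq; auto; lra.
  - intros i _. rewrite <- sign_mul_omega.
    assert (HZ := omega2_add_neq_0 h i c Hc).
    assert (HwC : RtoC w <> 0%C) by (apply RtoC_neq_0; lra).
    replace (w * omega h i * (w * omega h i) + RtoC (r ^ 2))%C with (w * w * (omega2 h i + c))%C.
    + rewrite RtoC_div by lra. field. auto.
    + unfold c, omega2. rewrite RtoC_pow, RtoC_div, RtoC_pow by lra. field. auto.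
Qed.

(** The signed [1 / omega] is [omega2^h], whose sum over the roots of unity vanishes unless
    [h = 0]. *)
Lemma Csum_inv_omega (h : nat) (w : R) : 0 < w ->
  Csum (fun i => RtoC (powerRZ (-1) (Z.of_nat i - Z.of_nat h)) * (2 / (w * omega h i)))%C (2 * h + 1) =
  RtoC (if (h =? 0)%nat then 2 / w else 0).
Proof.
  intros Hw. assert (HwC : RtoC w <> 0%C) by (apply RtoC_neq_0; lra).
  rewrite (Csum_ext _ (fun i => RtoC (2 / w) * (omega2 h i ^ h))%C).
  - rewrite Csum_scal. destruct h as [|h].
    + simpl. ring.
    + rewrite Csum_omega2_pow by lia. simpl. ring.
  - intros i _. rewrite <- sign_div_omega, RtoC_div by lra.
    assert (H := omega_neq_0 h i). field. auto.
Qed.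

Lemma sum_pow_m1_even (n : nat) : sum_f_R0 (fun i => (-1) ^ i) (2 * n) = 1.
Proof.
  induction n. reflexivity.
  replace (2 * S n)%nat with (S (S (2 * n))) by lia. rewrite !tech5, IHn. simpl pow.
  ring.
Qed.

Lemma Csum_sign (h : nat) :
  Csum (fun i => RtoC (powerRZ (-1) (Z.of_nat i - Z.of_nat h))) (2 * h + 1) = RtoC ((-1) ^ h).
Proof.
  rewrite Nat.add_1_r, (Csum_RtoC (fun i => powerRZ (-1) (Z.of_nat i - Z.of_nat h))). f_equal.
  rewrite (sum_eq _ (fun i => (-1) ^ i * (-1) ^ h)) by (intros; apply powerRZ_m1_sub).
  rewrite <- scal_sum, sum_pow_m1_even. ring.
Qed.

(** [1 / (e^z - 1) = ((coth2 z - 2 / z) + 2 / z - 1) / 2], and the three parts are summed over the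
    roots of unity separately. *)
Lemma Csum_inv_Cexp (h : nat) (w : R) : 0 < w ->
  Csum (fun i => RtoC (powerRZ (-1) (Z.of_nat i - Z.of_nat h)) / (Cexp (w * omega h i) - 1))%C (2 * h + 1) =
  RtoC (/ 2 * ((if (h =? 0)%nat then 2 / w else 0) +
    Series (fun l => (-1) ^ h * (4 * INR (2 * h + 1) * (2 * PI * INR (S l)) ^ (2 * h) * w ^ (2 * h + 1)
      / (w ^ (2 * (2 * h + 1)) + (2 * PI * INR (S l)) ^ (2 * (2 * h + 1))))) - (-1) ^ h)).
Proof.
  intros Hw.
  assert (S1 := is_Cseries_Csum
    (fun i k => (RtoC (powerRZ (-1) (Z.of_nat i - Z.of_nat h)) *
       (4 * (w * omega h i) / (w * omega h i * (w * omega h i) + RtoC ((2 * PI * INR (S k)) ^ 2))))%C)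
    (fun i => (RtoC (powerRZ (-1) (Z.of_nat i - Z.of_nat h)) * (coth2 (w * omega h i) - 2 / (w * omega h i)))%C) (2 * h + 1)).
  cbv beta in S1.
  assert (S2 := S1 ltac:(intros i Hi; apply is_Cseries_scal, coth2_expansion, fst_scal_omega_pos; auto)). clear S1.
  refine (_ (is_Cseries_ext _ _ _ (fun k => Csum_coth2_term h w (2 * PI * INR (S k)) Hw _) S2)).
  - intros S3. apply is_Cseries_RtoC in S3. destruct S3 as [S3 _].
    rewrite (Csum_ext _ (fun i => / 2 * (RtoC (powerRZ (-1) (Z.of_nat i - Z.of_nat h)) * (coth2 (w * omega h i) - 2 / (w * omega h i))
       + (RtoC (powerRZ (-1) (Z.of_nat i - Z.of_nat h)) * (2 / (w * omega h i))
       + - (1) * RtoC (powerRZ (-1) (Z.of_nat i - Z.of_nat h)))))%C).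
    + rewrite Csum_scal, !Csum_plus, Csum_scal, S3, Csum_inv_omega, Csum_sign by auto.
      rewrite RtoC_mult, RtoC_minus, RtoC_plus, RtoC_inv by lra. ring.
    + intros i Hi. assert (H1 := Cexp_sub_1_neq_0 _ (fst_scal_omega_pos h i w Hi Hw)).
      unfold coth2. field. repeat split; auto. apply omega_neq_0. apply RtoC_neq_0; lra.
  - assert (H := INR_S_pos k). assert (HP := PI_RGT_0). apply Rmult_lt_0_compat; lra.
Qed.

(** * The two sides as lattice sums *)

(** Identities between real powers are proved on exponents: after [ln_alpha] eliminates [ln alpha],
    both sides are combinations of [ln 2], [ln PI] and [ln beta]. *)
Lemma pow_exp_ln (x : R) (n : nat) : 0 < x -> x ^ n = exp (INR n * ln x).
Proof. intros H. rewrite <- Rpower_pow by auto. reflexivity. Qed.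

Lemma ln_alpha (N : nat) (alpha beta : R) : 0 < alpha -> 0 < beta ->
  alpha * beta ^ N = PI ^ (N + 1) -> ln alpha = INR (N + 1) * ln PI - INR N * ln beta.
Proof.
  intros Ha Hb H. apply (f_equal ln) in H. assert (HP := PI_RGT_0).
  rewrite ln_mult, !ln_pow in H; auto. lra. now apply pow_lt.
Qed.

(** The value of [tau]. Under the relation between [alpha] and [beta] it also equals
    [2^N alpha / (2 PI)]. *)
Definition scale (N : nat) (beta : R) : R := (2 * PI) ^ N / (2 * beta ^ N).

Lemma scale_pos (N : nat) (beta : R) : 0 < beta -> 0 < scale N beta.
Proof.
  intros Hb. assert (HP := PI_RGT_0). apply Rdiv_lt_0_compat. apply pow_lt; lra.
  apply Rmult_lt_0_compat. lra. now apply pow_lt.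
Qed.

Lemma ln_scale (N : nat) (beta : R) : 0 < beta ->
  ln (scale N beta) = INR N * (ln 2 + ln PI) - ln 2 - INR N * ln beta.
Proof.
  intros Hb. assert (HP := PI_RGT_0). assert (0 < beta ^ N) by now apply pow_lt.
  unfold scale. rewrite ln_div, ln_mult, !ln_pow, ln_mult; auto; try lra. apply pow_lt; lra.
Qed.

(** The factor before the bracket in the theorem, without its sign [(-1)^m] and its [1 / N]. *)
Definition prefactor (N m : nat) (beta : R) : R :=
  / Rpower beta (INR (2 * N) / INR (N + 1)) ^ m * 2 ^ (2 * m * (N - 1)).

Lemma prefactor_exp (N m : nat) (beta : R) : (1 <= N)%nat ->
  prefactor N m beta =
  exp (- (INR m * (2 * INR N / (INR N + 1) * ln beta)) + 2 * INR m * (INR N - 1) * ln 2).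
Proof.
  intros HN. unfold prefactor.
  rewrite (pow_exp_ln (Rpower _ _)) by apply exp_pos. rewrite (pow_exp_ln 2) by lra.
  unfold Rpower. rewrite ln_exp, <- exp_Ropp, <- exp_plus. f_equal.
  rewrite !mult_INR, minus_INR, plus_INR by auto. change (INR 2) with 2. change (INR 1) with 1. unfold Rdiv; ring.
Qed.

Lemma Rpower_alpha_prefactor (N m : nat) (alpha beta : R) : (1 <= N)%nat -> 0 < alpha -> 0 < beta ->
  alpha * beta ^ N = PI ^ (N + 1) ->
  Rpower alpha (- INR (2 * N * m) / INR (N + 1)) * scale N beta ^ (2 * m) = prefactor N m beta.
Proof.
  intros HN Ha Hb Hab. rewrite prefactor_exp, (pow_exp_ln (scale _ _)) by (auto; now apply scale_pos).
  unfold Rpower. rewrite <- exp_plus. f_equal.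
  rewrite ln_scale, (ln_alpha N alpha beta) by auto.
  rewrite !mult_INR, plus_INR. change (INR 2) with 2. change (INR 1) with 1.
  assert (H := pos_INR N). field. lra.
Qed.

(** [d] stands for [m - j] and is real because it may be [-1]. The powers of [2 PI] and the [4] are
    what two applications of Euler's formula absorb. *)
Lemma bernoulli_powers (N m j idx : nat) (d alpha beta : R) : (1 <= N)%nat -> 0 < alpha -> 0 < beta ->
  alpha * beta ^ N = PI ^ (N + 1) ->
  INR j + d = INR m -> INR idx = INR N + 1 + 2 * INR N * d ->
  2 ^ (2 * N * m) * Rpower alpha (INR (2 * j) / INR (N + 1))
    * Rpower beta (INR N + 2 * INR N ^ 2 * d / INR (N + 1)) =
  prefactor N m beta / PI * Rpower (scale N beta) (- (1 + 2 * d)) * (2 * PI) ^ (2 * j) * (2 * PI) ^ idx / 4.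
Proof.
  intros HN Ha Hb Hab Hd Hi. assert (HP := PI_RGT_0). rewrite prefactor_exp by auto.
  replace 4 with (exp (2 * ln 2)) by (change 2 with (INR 2) at 1; rewrite <- pow_exp_ln; simpl; lra).
  unfold Rdiv at 3 4. rewrite <- (exp_Ropp (2 * ln 2)).
  replace (/ PI) with (exp (- ln PI)) by (rewrite exp_Ropp, exp_ln; auto).
  rewrite (pow_exp_ln 2), !(pow_exp_ln (2 * PI)) by lra.
  unfold Rpower. rewrite <- !exp_plus. f_equal.
  rewrite ln_scale, (ln_alpha N alpha beta), ln_mult by (auto; lra).
  rewrite Hi, !mult_INR, plus_INR, <- Hd. change (INR 2) with 2. change (INR 1) with 1.
  assert (H := pos_INR N). field. lra.
Qed.

Lemma eta_even_bernoulli (j : nat) : (1 <= j)%nat ->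
  (powerRZ 2 (1 - 2 * Z.of_nat j) - 1) * bernoulli (2 * j) * (2 * PI) ^ (2 * j) / (2 * INR (fact (2 * j))) =
  (-1) ^ S j * eta_even j.
Proof.
  intros Hj. unfold eta_even. rewrite Series_alt_pow, zeta_nat_even by lia.
  replace (powerRZ 2 (1 - 2 * Z.of_nat j)) with (2 / 2 ^ (2 * j)).
  - assert (E := pow_m1_sqr (S j)).
    rewrite <- (Rmult_1_l ((_ - 1) * _ * _ / _)), <- E. unfold Rdiv. ring.
  - unfold Z.sub. rewrite powerRZ_add by lra. rewrite powerRZ_neg'.
    replace (2 * Z.of_nat j)%Z with (Z.of_nat (2 * j)) by lia. rewrite <- pow_powerRZ.
    change (powerRZ 2 1) with (2 ^ 1). rewrite pow_1. reflexivity.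
Qed.

(** Here [idx = 2 p] with [p = h + 1 + (2 h + 1) d], so [p + 1] has the parity of [h + d]; with
    [j + d = m], Euler's sign [(-1)^(p+1)] is [(-1)^(m+h) (-1)^j]. *)
Lemma zeta_idx_bernoulli (h m j d idx : nat) : (j + d = m)%nat ->
  (idx = 2 * h + 1 + 1 + 2 * (2 * h + 1) * d)%nat ->
  (-1) ^ (m + h) * bernoulli idx * (2 * PI) ^ idx / (2 * INR (fact idx)) = (-1) ^ j * zeta_nat idx.
Proof.
  intros Hj Hi. set (p := (h + 1 + (2 * h + 1) * d)%nat).
  replace idx with (2 * p)%nat by (unfold p; lia).
  rewrite zeta_nat_even by (unfold p; lia).
  assert (E : (-1) ^ (m + h) = (-1) ^ j * (-1) ^ S p).
  { rewrite <- pow_add. subst m. unfold p.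
    replace (j + S (h + 1 + (2 * h + 1) * d))%nat with (2 * (1 + h * d) + (j + d + h))%nat by nia.
    rewrite (pow_add _ (2 * _)), pow_1_even. ring. }
  rewrite E. unfold Rdiv. ring.
Qed.

(** [inv_sinh_expansion] is used at [x = PI Q_l]: its pole [1 / x] yields the zeta value, its series
    one row of the lattice sum. *)
Lemma inv_sinh_series (N m : nat) (alpha beta : R) : (1 <= N)%nat -> (1 <= m)%nat -> 0 < alpha -> 0 < beta ->
  alpha * beta ^ N = PI ^ (N + 1) ->
  Series (fun n =>
      let k := INR (S n) in
      / k ^ (2 * N * m + 1) * exp (- (1 / 2) * (2 * k) ^ N * alpha)
        / (1 - exp (- (2 * k) ^ N * alpha))) =
  / (2 * PI * scale N beta) * zeta_nat (2 * N * m + 1 + N)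
  + scale N beta ^ (2 * m) / PI * lattice_sum (scale N beta) N m 0.
Proof.
  intros HN Hm Ha Hb Hab. set (tau := scale N beta). assert (Ht : 0 < tau) by now apply scale_pos.
  destruct (lattice_sum_swap tau N m 0 Ht HN ltac:(lia)) as [E1 [E2 _]].
  assert (HP := PI_RGT_0).
  unfold zeta_nat, lattice_sum. rewrite <- !Series_scal_l, <- Series_plus.
  2:{ apply ex_series_scal_R, ex_series_inv_pow. lia. }
  2:{ now apply ex_series_scal_R. }
  apply Series_ext. intros l. cbv zeta. set (q := dilate tau N l).
  assert (Hq : 0 < q) by now apply dilate_pos. assert (Hl := INR_S_pos l).
  assert (Q : (2 * INR (S l)) ^ N * alpha = 2 * (PI * q)).
  { unfold q, dilate, tau, scale. rewrite !Rpow_mult_distr.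
    assert (0 < beta ^ N) by now apply pow_lt.
    replace alpha with (PI ^ (N + 1) / beta ^ N) by (rewrite <- Hab; field; lra).
    rewrite Nat.add_1_r. simpl pow. field. lra. }
  replace (- (1 / 2) * (2 * INR (S l)) ^ N * alpha) with (- (PI * q))
    by (replace (PI * q) with ((2 * INR (S l)) ^ N * alpha / 2) by lra; field).
  replace (- (2 * INR (S l)) ^ N * alpha) with (- (2 * (PI * q))) by lra.
  unfold Rdiv at 1. rewrite Rmult_assoc.
  change (exp (- (PI * q)) * / (1 - exp (- (2 * (PI * q))))) with (exp (- (PI * q)) / (1 - exp (- (2 * (PI * q))))).
  rewrite inv_sinh_expansion by now apply Rmult_lt_0_compat.
  (* Trades [l^(-2 N m)] for [Q_l^(-2 m)], which costs the factor [tau^(2 m)] in front of the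
     lattice sum. *)
  assert (X : INR (S l) ^ (2 * N * m + 1) * tau ^ (2 * m) = INR (S l) * q ^ (2 * m)).
  { unfold q, dilate. rewrite Rpow_mult_distr, <- pow_mult, pow_add, pow_1.
    replace (N * (2 * m))%nat with (2 * N * m)%nat by lia. ring. }
  assert (P1 : 0 < INR (S l) ^ (2 * N * m + 1)) by now apply pow_lt.
  assert (P2 : 0 < tau ^ (2 * m)) by now apply pow_lt. assert (P3 : 0 < q ^ (2 * m)) by now apply pow_lt.
  assert (S1 : Series (fun k => (-1) ^ S k * (2 * (PI * q) / ((PI * q) ^ 2 + (PI * INR (S k)) ^ 2))) =
     2 / PI * INR (S l) * q ^ (2 * m) * Series (fun k => lattice_term tau N m 0 l k)).
  { rewrite <- Series_scal_l. apply Series_ext. intros k. unfold lattice_term. fold q.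
    assert (Hk := INR_S_pos k). simpl (_ ^ (2 * 0)).
    revert P3. generalize (q ^ (2 * m)) ((-1) ^ S k). intros u s Hu.
    assert (0 < q ^ 2 + INR (S k) ^ 2) by nra.
    replace ((PI * q) ^ 2 + (PI * INR (S k)) ^ 2) with (PI ^ 2 * (q ^ 2 + INR (S k) ^ 2)) by ring.
    revert H. generalize (q ^ 2 + INR (S k) ^ 2). intros v Hv.
    field. repeat split; apply Rgt_not_eq; auto. }
  rewrite S1. clear S1.
  rewrite (pow_add _ (2 * N * m + 1) N).
  assert (Y : q = tau * INR (S l) ^ N) by reflexivity.
  assert (P4 : 0 < INR (S l) ^ N) by now apply pow_lt.
  generalize (Series (fun k => lattice_term tau N m 0 l k)). intros SS.
  rewrite Rmult_plus_distr_l.  rewrite Rmult_plus_distr_l. f_equal.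
  - rewrite Y. field. repeat split; apply Rgt_not_eq; auto.
  - replace (/ INR (S l) ^ (2 * N * m + 1) * (/ 2 * (2 / PI * INR (S l) * q ^ (2 * m) * SS)))
      with (/ INR (S l) ^ (2 * N * m + 1) * / PI * (INR (S l) * q ^ (2 * m)) * SS) by (field; split; lra).
    rewrite <- X. field. split; lra.
Qed.

(** Kept convertible to the summand in the theorem for [N = 2 h + 1], so that it can be folded there
    by [change]. *)
Definition rhs_inner (h m : nat) (beta : R) (i n : nat) : C :=
  (RtoC ((-1) ^ (S n) / INR (S n) ^ (2 * m + 1)) /
   (Cexp (RtoC (Rpower (2 * INR (S n)) (/ INR (2 * h + 1)) * beta) * omega h i) - 1))%C.

Definition root_w (h : nat) (beta : R) (n : nat) : R := Rpower (2 * INR (S n)) (/ INR (2 * h + 1)) * beta.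

Lemma root_w_pos (h : nat) (beta : R) (n : nat) : 0 < beta -> 0 < root_w h beta n.
Proof. intros H. apply Rmult_lt_0_compat; auto. apply exp_pos. Qed.

Lemma root_w_pow (h : nat) (beta : R) (n : nat) :
  root_w h beta n ^ (2 * h + 1) = 2 * INR (S n) * beta ^ (2 * h + 1).
Proof.
  unfold root_w. rewrite Rpow_mult_distr. f_equal.
  rewrite <- Rpower_pow by apply exp_pos. rewrite Rpower_mult, Rinv_l, Rpower_1; auto.
  - assert (H := INR_S_pos n). lra.
  - assert (H := INR_odd_pos h). lra.
Qed.

Lemma root_w_ge (h : nat) (beta : R) (n : nat) : 0 < beta -> beta <= root_w h beta n.
Proof.
  intros Hb. unfold root_w. rewrite <- (Rmult_1_l beta) at 1. apply Rmult_le_compat_r. lra.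
  assert (H := INR_S_ge_1 n). rewrite <- (Rpower_O (2 * INR (S n))) by lra.
  apply Rle_Rpower. lra. apply Rlt_le, Rinv_0_lt_compat, INR_odd_pos.
Qed.

Lemma Cmod_Cexp_sub_1_ge (z : C) : fst z <= Cmod (Cexp z - 1).
Proof.
  assert (H := Cmod_triangle (Cexp z - 1) 1). replace (Cexp z - 1 + 1)%C with (Cexp z) in H by ring.
  rewrite Cmod_Cexp, Cmod_1 in H.
  destruct (Req_dec (fst z) 0) as [->|N]. apply Cmod_ge_0.
  assert (G := exp_ineq1 (fst z) N). lra.
Qed.

(** [|e^z - 1| >= Re z] bounds the denominators below by [beta Re omega], uniformly in [n]; the
    decay comes from [n^(-2 m - 1)] alone. *)
Lemma rhs_inner_series (h m : nat) (beta : R) (i : nat) : 0 < beta -> (1 <= m)%nat -> (i < 2 * h + 1)%nat ->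
  is_Cseries (rhs_inner h m beta i) (CSeries (rhs_inner h m beta i)).
Proof.
  intros Hb Hm Hi. assert (HO := fst_omega_pos h i Hi).
  apply ex_Cseries_dom with (fun n => / (beta * fst (omega h i)) * / INR (S n) ^ 2).
  - intros n. unfold rhs_inner. fold (root_w h beta n).
    assert (Hw := root_w_pos h beta n Hb). assert (Hg := root_w_ge h beta n Hb).
    assert (P := fst_scal_omega_pos h i _ Hi Hw).
    rewrite Cmod_div by now apply Cexp_sub_1_neq_0.
    rewrite Cmod_R. unfold Rdiv. rewrite Rabs_mult, pow_1_abs, Rmult_1_l.
    destruct (inv_pow_le_inv_sq (2 * m + 1) n ltac:(lia)) as [B1 B2].
    rewrite Rabs_pos_eq by lra. rewrite Rmult_comm.
    assert (Q : beta * fst (omega h i) <= Cmod (Cexp (root_w h beta n * omega h i) - 1)).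
    { eapply Rle_trans; [|apply Cmod_Cexp_sub_1_ge].
      replace (fst (root_w h beta n * omega h i)%C) with (root_w h beta n * fst (omega h i)) by (simpl; ring).
      apply Rmult_le_compat_r; lra. }
    assert (0 < beta * fst (omega h i)) by now apply Rmult_lt_0_compat.
    apply Rmult_le_compat; try lra. apply Rlt_le, Rinv_0_lt_compat; lra.
    apply Rinv_le_contravar; auto.
  - apply ex_series_scal_R, ex_series_inv_sq.
Qed.

Lemma ex_series_eta_pow (s : nat) : (2 <= s)%nat -> ex_series (fun k => (-1) ^ S k / INR (S k) ^ s).
Proof.
  intros Hs. apply (ex_series_alt (fun k => / INR (S k) ^ s)).
  refine (ex_series_ext_R _ _ _ (ex_series_inv_pow s Hs)).
  intros n. symmetry. apply Rabs_pos_eq, Rlt_le, inv_pow_le_inv_sq, Hs.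
Qed.

(** For fixed [n] the roots of unity are summed first, by [Csum_inv_Cexp]. This leaves a real series
    over [n] of three parts: polar terms, columns of the lattice sum, and the constant that produces
    [zeta (2 m + 1)]. *)
Lemma rhs_sum (h m : nat) (beta : R) : 0 < beta -> (1 <= m)%nat ->
  Csum (fun i => RtoC (powerRZ (-1) (Z.of_nat i - Z.of_nat h)) * CSeries (rhs_inner h m beta i))%C (2 * h + 1) =
  RtoC ((if (h =? 0)%nat then / (2 * beta) * eta_even (S m) else 0)
    + (-1) ^ h * (INR (2 * h + 1) / PI * lattice_sum (scale (2 * h + 1) beta) (2 * h + 1) 0 m
                  - / 2 * (/ 2 ^ (2 * m) - 1) * zeta_nat (2 * m + 1))).
Proof.
  intros Hb Hm. set (N := (2 * h + 1)%nat). set (tau := scale N beta).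
  assert (Ht : 0 < tau) by now apply scale_pos. assert (HP := PI_RGT_0).
  destruct (lattice_sum_swap tau N 0 m Ht ltac:(lia) ltac:(lia)) as [_ [_ E3]].
  assert (EX : ex_series (fun k => Series (fun l => lattice_term tau N 0 m l k))).
  { destruct (lattice_term_bound tau N 0 m Ht ltac:(lia) ltac:(lia)) as [C0 [HC HB]].
    assert (P : forall n, 0 <= / INR (S n) ^ 2) by (intros; apply Rlt_le, Rinv_0_lt_compat, pow_lt, INR_S_pos).
    destruct (Series_swap (lattice_term tau N 0 m) (fun l => C0 * / INR (S l) ^ 2) (fun k => / INR (S k) ^ 2)) as [_ [H1 _]]; auto.
    apply ex_series_scal_R, ex_series_inv_sq. apply ex_series_inv_sq. intros n. now apply Rmult_le_pos. }
  assert (S1 : is_Cseries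
     (fun n => Csum (fun i => RtoC (powerRZ (-1) (Z.of_nat i - Z.of_nat h)) * rhs_inner h m beta i n)%C N)
     (Csum (fun i => RtoC (powerRZ (-1) (Z.of_nat i - Z.of_nat h)) * CSeries (rhs_inner h m beta i))%C N)).
  { apply (is_Cseries_Csum (fun i n => (RtoC (powerRZ (-1) (Z.of_nat i - Z.of_nat h)) * rhs_inner h m beta i n)%C)).
    intros i Hi. now apply is_Cseries_scal, rhs_inner_series. }
  set (t := fun n => (if (h =? 0)%nat then / (2 * beta) else 0) * ((-1) ^ S n / INR (S n) ^ (2 * S m))
     + ((-1) ^ h * (INR N / PI) * Series (fun l => lattice_term tau N 0 m l n)
        + (- (-1) ^ h * / 2) * ((-1) ^ S n / INR (S n) ^ (2 * m + 1)))).
  apply (is_Cseries_ext _ (fun n => RtoC (t n))) in S1.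
  - apply is_Cseries_RtoC in S1. destruct S1 as [S1 _]. rewrite S1. f_equal. unfold t.
    assert (X1 := ex_series_eta_pow (2 * S m) ltac:(lia)). assert (X2 := ex_series_eta_pow (2 * m + 1) ltac:(lia)).
    rewrite Series_plus, Series_plus, !Series_scal_l, (Series_alt_pow (2 * m + 1)), <- E3 by
      (auto using ex_series_scal_R, ex_series_plus_R; lia).
    replace (2 / 2 ^ (2 * m + 1)) with (/ 2 ^ (2 * m))
      by (rewrite (pow_add 2 _ 1); assert (H2 := pow_nonzero 2 (2 * m) ltac:(lra)); field; auto).
    unfold eta_even. destruct (h =? 0)%nat; unfold Rdiv; ring.
  - intros n. assert (Hw := root_w_pos h beta n Hb). assert (Hn := INR_S_pos n).
    rewrite (Csum_ext _ (fun i => RtoC ((-1) ^ S n / INR (S n) ^ (2 * m + 1)) *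
      (RtoC (powerRZ (-1) (Z.of_nat i - Z.of_nat h)) / (Cexp (root_w h beta n * omega h i) - 1)))%C).
    2:{ intros i Hi. unfold rhs_inner. fold (root_w h beta n). unfold Cdiv. ring. }
    rewrite Csum_scal. unfold N at 1. rewrite Csum_inv_Cexp, <- RtoC_mult by auto. f_equal. unfold t.
    rewrite (Series_ext _ (fun l => (-1) ^ h * (2 * INR N / PI) * INR (S n) * INR (S n) ^ (2 * m) * (-1) ^ S n * lattice_term tau N 0 m l n)).
    + rewrite Series_scal_l.
      replace (2 * S m)%nat with (2 * m + 2)%nat by lia. rewrite !pow_add, pow_1.
      assert (H0 : 0 < INR (S n) ^ (2 * m)) by now apply pow_lt.
      assert (ES := pow_m1_sqr (S n)).
      (* For [N = 1] the polar term is [2 / w = 1 / (n beta)]; the additional [1 / n] turns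
         [n^(-2 m - 1)] into the even power of [eta_even (S m)]. *)
      assert (D : (if (h =? 0)%nat then 2 / root_w h beta n else 0) = (if (h =? 0)%nat then / (2 * beta) else 0) * (2 / INR (S n))).
      { destruct (Nat.eqb_spec h 0) as [H|H].
        - assert (G := root_w_pow h beta n). subst h. simpl (2 * 0 + 1)%nat in G. rewrite !pow_1 in G. rewrite G. field. lra.
        - ring. }
      rewrite D. generalize (if (h =? 0)%nat then / (2 * beta) else 0).
      revert H0 ES. generalize (INR (S n) ^ (2 * m)) ((-1) ^ S n) ((-1) ^ h) (Series (fun l => lattice_term tau N 0 m l n)).
      intros u s e SS Hu ES dd.
      replace (s / (u * INR (S n)) * (/ 2 * (dd * (2 / INR (S n)) + e * (2 * INR N / PI) * INR (S n) * u * s * SS - e)))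
        with (dd * (s / (u * INR (S n) ^ 2)) + ((s * s) * e * (INR N / PI) * SS + - e * / 2 * (s / (u * INR (S n))))) by (field; repeat split; lra).
      rewrite ES. ring.
    + intros l. fold N. set (q := dilate tau N l). assert (Hq : 0 < q) by now apply dilate_pos.
      assert (Hl := INR_S_pos l). assert (HbN : 0 < beta ^ N) by now apply pow_lt.
      assert (W := root_w_pow h beta n). fold N in W.
      assert (R1 : (2 * PI * INR (S l)) ^ N = 2 * beta ^ N * q).
      { unfold q, dilate, tau, scale. rewrite (Rpow_mult_distr (2 * PI)). field. lra. }
      (* Writing the power [2 h = N - 1] as the [N]-th power divided by [2 PI l] is the origin of
         the weight [Q_l / l]. *)
      assert (R2 : (2 * PI * INR (S l)) ^ (2 * h) = 2 * beta ^ N * q / (2 * PI * INR (S l))).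
      { rewrite <- R1. unfold N. rewrite (pow_add _ (2 * h) 1), pow_1. field. lra. }
      rewrite R2, !(Nat.mul_comm 2 N), !(pow_mult _ N 2), W, R1. unfold lattice_term. fold q.
      assert (H0 : 0 < INR (S n) ^ (2 * m)) by now apply pow_lt.
      assert (ES := pow_m1_sqr (S n)). simpl (q ^ (2 * 0)).
      assert (D : 0 < q ^ 2 + INR (S n) ^ 2) by nra.
      replace ((2 * INR (S n) * beta ^ N) ^ 2 + (2 * beta ^ N * q) ^ 2) with (4 * beta ^ N * beta ^ N * (q ^ 2 + INR (S n) ^ 2)) by ring.
      revert H0 ES D. generalize (INR (S n) ^ (2 * m)) ((-1) ^ S n) ((-1) ^ h) (q ^ 2 + INR (S n) ^ 2). intros u s e v Hu ES Hv.
      transitivity (s * s * (e * (4 * INR N * (2 * beta ^ N * q / (2 * PI * INR (S l))) * (2 * INR (S n) * beta ^ N) / (4 * beta ^ N * beta ^ N * v)))).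
      rewrite ES; ring. revert HbN. generalize (beta ^ N). intros bN HbN.
      field. repeat split; lra.
Qed.

(** * The Bernoulli sum *)

(** The summand of the theorem. For [N = 1] and [j = m + 1] one has [d = -1] and [idx = 0], which is
    why [d] is an integer and truncation occurs only after forming [idx]. *)
Definition bernoulli_summand (N m : nat) (alpha beta : R) (j : nat) : R :=
  let d : Z := (Z.of_nat m - Z.of_nat j)%Z in
  let idx : nat := Z.to_nat (Z.of_nat (N + 1) + 2 * Z.of_nat N * d)%Z in
  (-1) ^ j * (powerRZ 2 (1 - 2 * Z.of_nat j) - 1)
    * bernoulli (2 * j) * bernoulli idx
    / (INR (fact (2 * j)) * INR (fact idx))
    * Rpower alpha (INR (2 * j) / INR (N + 1))
    * Rpower beta (INR N + 2 * INR N ^ 2 * IZR d / INR (N + 1)).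

(** Splits the summand into real powers and two factors in the shape of [eta_even_bernoulli] and
    [zeta_idx_bernoulli], so that each case of [j] only has to evaluate these. *)
Lemma bernoulli_summand_eval (h m j idx : nat) (d : Z) (alpha beta : R) : 0 < alpha -> 0 < beta ->
  alpha * beta ^ (2 * h + 1) = PI ^ (2 * h + 1 + 1) ->
  (Z.of_nat m - Z.of_nat j = d)%Z ->
  (Z.of_nat idx = Z.of_nat (2 * h + 1 + 1) + 2 * Z.of_nat (2 * h + 1) * d)%Z ->
  (-1) ^ (m + (h + 2)) * 2 ^ (2 * (2 * h + 1) * m) * bernoulli_summand (2 * h + 1) m alpha beta j =
  (-1) ^ j * (prefactor (2 * h + 1) m beta / PI * Rpower (scale (2 * h + 1) beta) (- (1 + 2 * IZR d))) *
  ((powerRZ 2 (1 - 2 * Z.of_nat j) - 1) * bernoulli (2 * j) * (2 * PI) ^ (2 * j) / (2 * INR (fact (2 * j)))) *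
  ((-1) ^ (m + h) * bernoulli idx * (2 * PI) ^ idx / (2 * INR (fact idx))).
Proof.
  intros Ha Hb Hab Hd Hi. unfold bernoulli_summand. rewrite Hd, <- Hi, Nat2Z.id.
  assert (P := bernoulli_powers (2 * h + 1) m j idx (IZR d) alpha beta ltac:(lia) Ha Hb Hab).
  rewrite <- Hd in P at 1. rewrite minus_IZR, <- !INR_IZR_INZ in P. specialize (P ltac:(ring)).
  assert (Q : INR idx = INR (2 * h + 1) + 1 + 2 * INR (2 * h + 1) * IZR d).
  { rewrite INR_IZR_INZ, Hi, plus_IZR, !mult_IZR, <- !INR_IZR_INZ, (plus_INR (2 * h + 1)). reflexivity. }
  specialize (P Q).
  assert (F1 := INR_fact_neq_0 (2 * j)). assert (F2 := INR_fact_neq_0 idx).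
  replace (m + (h + 2))%nat with (m + h + 2)%nat by lia. rewrite (pow_add _ (m + h) 2).
  replace ((-1) ^ 2) with 1 by ring.
  transitivity ((-1) ^ (m + h) * ((-1) ^ j * (powerRZ 2 (1 - 2 * Z.of_nat j) - 1) * bernoulli (2 * j) * bernoulli idx
    / (INR (fact (2 * j)) * INR (fact idx))) * (2 ^ (2 * (2 * h + 1) * m) * Rpower alpha (INR (2 * j) / INR (2 * h + 1 + 1)) *
    Rpower beta (INR (2 * h + 1) + 2 * INR (2 * h + 1) ^ 2 * IZR d / INR (2 * h + 1 + 1)))).
  ring. rewrite P.
  generalize (Rpower (scale (2 * h + 1) beta) (- (1 + 2 * IZR d))) (prefactor (2 * h + 1) m beta)
    ((2 * PI) ^ (2 * j)) ((2 * PI) ^ idx) (powerRZ 2 (1 - 2 * Z.of_nat j)) ((-1) ^ j) ((-1) ^ (m + h)).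
  assert (HP := PI_RGT_0). intros. field. repeat split; auto; lra.
Qed.

Lemma Rpower_odd_neg (x : R) (n : nat) : 0 < x -> Rpower x (- (1 + 2 * INR n)) = x / x ^ (2 * S n).
Proof.
  intros Hx. rewrite Rpower_Ropp.
  replace (1 + 2 * INR n) with (INR (S (2 * n))) by (rewrite S_INR, mult_INR; change (INR 2) with 2; ring).
  rewrite Rpower_pow by auto. replace (2 * S n)%nat with (S (S (2 * n))) by lia.
  rewrite <- (tech_pow_Rmult x (S (2 * n))).
  assert (0 < x ^ S (2 * n)) by now apply pow_lt. field. lra.
Qed.

(** At [j = 0] the eta factor is [(2 - 1) B_0 / 2 = 1 / 2]. The result is the zeta value left by the
    poles in [inv_sinh_series]. *)
Lemma bernoulli_summand_0 (h m : nat) (alpha beta : R) : 0 < alpha -> 0 < beta ->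
  alpha * beta ^ (2 * h + 1) = PI ^ (2 * h + 1 + 1) ->
  (-1) ^ (m + (h + 2)) * 2 ^ (2 * (2 * h + 1) * m) * bernoulli_summand (2 * h + 1) m alpha beta 0 =
  prefactor (2 * h + 1) m beta / PI * (scale (2 * h + 1) beta / scale (2 * h + 1) beta ^ (2 * S m)) / 2
  * zeta_nat (2 * (2 * h + 1) * m + 1 + (2 * h + 1)).
Proof.
  intros Ha Hb Hab.
  rewrite (bernoulli_summand_eval h m 0 (2 * (2 * h + 1) * m + 1 + (2 * h + 1)) (Z.of_nat m)) by (auto; lia).
  rewrite (zeta_idx_bernoulli h m 0 m) by lia.
  rewrite <- INR_IZR_INZ, Rpower_odd_neg by now apply scale_pos.
  change (2 * 0)%nat with O. change (bernoulli 0) with 1. change (1 - 2 * Z.of_nat 0)%Z with 1%Z. simpl (fact 0).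
  rewrite powerRZ_1. simpl (INR 1). rewrite !pow_O. lra.
Qed.

(** Up to the common factor, this is the [b]-th correction in [lattice_sum_telescope]. *)
Lemma bernoulli_summand_S (h m b : nat) (alpha beta : R) : 0 < alpha -> 0 < beta ->
  alpha * beta ^ (2 * h + 1) = PI ^ (2 * h + 1 + 1) -> (b <= m)%nat ->
  (-1) ^ (S m + (h + 2)) * 2 ^ (2 * (2 * h + 1) * S m) * bernoulli_summand (2 * h + 1) (S m) alpha beta (S b) =
  prefactor (2 * h + 1) (S m) beta / PI *
  ((-1) ^ b * (scale (2 * h + 1) beta / scale (2 * h + 1) beta ^ (2 * S (m - b))
     * zeta_nat (2 * (2 * h + 1) * S (m - b) + 1 - (2 * h + 1)) * eta_even (S b))).
Proof.
  intros Ha Hb Hab Hbm.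
  rewrite (bernoulli_summand_eval h (S m) (S b) (2 * (2 * h + 1) * S (m - b) + 1 - (2 * h + 1)) (Z.of_nat (m - b))) by (auto; nia).
  rewrite (zeta_idx_bernoulli h (S m) (S b) (m - b)) by nia.
  rewrite <- INR_IZR_INZ, Rpower_odd_neg, eta_even_bernoulli by (auto using scale_pos; lia).
  assert (E := pow_m1_sqr (S b)).
  replace ((-1) ^ b) with ((-1) ^ (S (S b)) * ((-1) ^ S b * (-1) ^ S b)) by (rewrite E; simpl; ring).
  ring.
Qed.

(* The summand beyond [j = m] is present only for [N = 1]; it involves [B_0] in place of a
   zeta value and cancels the terms [2 / w] of the [coth] expansions. *)
Lemma bernoulli_summand_last (m : nat) (alpha beta : R) : 0 < alpha -> 0 < beta ->
  alpha * beta ^ 1 = PI ^ (1 + 1) ->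
  (-1) ^ (m + (0 + 2)) * 2 ^ (2 * 1 * m) * bernoulli_summand 1 m alpha beta (S m) =
  - ((-1) ^ m * prefactor 1 m beta * (/ (2 * beta) * eta_even (S m))).
Proof.
  intros Ha Hb Hab.
  assert (H := bernoulli_summand_eval 0 m (S m) 0 (-1) alpha beta Ha Hb Hab ltac:(lia) ltac:(lia)).
  change (2 * 0 + 1)%nat with 1%nat in H. rewrite H, eta_even_bernoulli by lia. clear H.
  replace (- (1 + 2 * -1)) with 1 by ring. rewrite Rpower_1 by now apply scale_pos.
  change (bernoulli 0) with 1. simpl (fact 0). simpl (INR 1). rewrite pow_O, Nat.add_0_r.
  unfold scale. rewrite !pow_1. assert (E := pow_m1_sqr m). assert (HP := PI_RGT_0).
  rewrite <- !(tech_pow_Rmult (-1)).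
  transitivity (- ((-1) ^ m * (-1) ^ m * (-1) ^ m * prefactor 1 m beta * (/ (2 * beta) * eta_even (S m)))).
  field. lra. rewrite E. ring.
Qed.

(** [(N+1) / (2 N)] equals [1] for [N = 1] and is below [1] for larger [N]. *)
Lemma floor_eq (h m : nat) :
  ((2 * h + 1 + 1 + 2 * (2 * h + 1) * m) / (2 * (2 * h + 1)))%nat = if (h =? 0)%nat then S m else m.
Proof.
  symmetry. destruct (Nat.eqb_spec h 0) as [->|H].
  - apply Nat.div_unique with 0%nat; lia.
  - apply Nat.div_unique with (2 * h + 1 + 1)%nat; lia.
Qed.

(** The three lines on the right come from [j = 0], from the telescoped range of positive [j] up to
    the first parameter of the lattice sums, and from the extra summand of [N = 1]. *)
Lemma sum_bernoulli_summands (h m : nat) (alpha beta : R) : 0 < alpha -> 0 < beta ->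
  alpha * beta ^ (2 * h + 1) = PI ^ (2 * h + 1 + 1) ->
  (-1) ^ (S m + (h + 2)) * 2 ^ (2 * (2 * h + 1) * S m) *
    sum_f_R0 (bernoulli_summand (2 * h + 1) (S m) alpha beta)
      ((2 * h + 1 + 1 + 2 * (2 * h + 1) * S m) / (2 * (2 * h + 1))) =
  prefactor (2 * h + 1) (S m) beta / PI * (scale (2 * h + 1) beta / scale (2 * h + 1) beta ^ (2 * S (S m))) / 2
    * zeta_nat (2 * (2 * h + 1) * S m + 1 + (2 * h + 1))
  + prefactor (2 * h + 1) (S m) beta / PI *
    (lattice_sum (scale (2 * h + 1) beta) (2 * h + 1) (S m) 0
     - (-1) ^ S m * lattice_sum (scale (2 * h + 1) beta) (2 * h + 1) 0 (S m))
  - (-1) ^ S m * prefactor (2 * h + 1) (S m) beta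
    * (if (h =? 0)%nat then / (2 * beta) * eta_even (S (S m)) else 0).
Proof.
  intros Ha Hb Hab.
  assert (M : (-1) ^ (S m + (h + 2)) * 2 ^ (2 * (2 * h + 1) * S m) *
    sum_f_R0 (bernoulli_summand (2 * h + 1) (S m) alpha beta) (S m) =
    prefactor (2 * h + 1) (S m) beta / PI * (scale (2 * h + 1) beta / scale (2 * h + 1) beta ^ (2 * S (S m))) / 2
    * zeta_nat (2 * (2 * h + 1) * S m + 1 + (2 * h + 1))
  + prefactor (2 * h + 1) (S m) beta / PI *
    (lattice_sum (scale (2 * h + 1) beta) (2 * h + 1) (S m) 0
     - (-1) ^ S m * lattice_sum (scale (2 * h + 1) beta) (2 * h + 1) 0 (S m))).
  { rewrite decomp_sum by lia. rewrite Rmult_plus_distr_l, bernoulli_summand_0 by auto. f_equal.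
    rewrite lattice_sum_telescope by (auto using scale_pos; lia).
    change (Nat.pred (S m)) with m.
    match goal with |- _ = ?p * (?x + ?s - ?x) => replace (p * (x + s - x)) with (p * s) by ring end.
    rewrite !scal_sum. apply sum_eq. intros b Hbm.
    rewrite Rmult_comm, bernoulli_summand_S by auto. ring. }
  rewrite floor_eq. destruct (Nat.eqb_spec h 0) as [H|H].
  - subst h. rewrite tech5, Rmult_plus_distr_l, M.
    change (2 * 0 + 1)%nat with 1%nat in *. rewrite (bernoulli_summand_last (S m)) by auto. ring.
  - rewrite M. ring.
Qed.

(** * Comparison of the two sides *)

Lemma sum_n_Csum (f : nat -> C) (n : nat) : sum_n f n = Csum f (S n).
Proof.
  induction n.
  - rewrite sum_O. simpl. now rewrite Cplus_0_l.
  - rewrite sum_Sn, IHn. reflexivity.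
Qed.

Theorem theorem1p6 (N : nat) (alpha beta : R)
  (HNodd : Nat.Odd N) (Halpha : 0 < alpha) (Hbeta : 0 < beta)
  (Hab : alpha * beta ^ N = PI ^ (N + 1))
  (m : nat) (Hm : (1 <= m)%nat) :
  RtoC
   (Rpower alpha (- (INR (2 * N * m)) / INR (N + 1)) *
    Series (fun n =>
      let k := INR (S n) in
      / k ^ (2 * N * m + 1) * exp (- (1 / 2) * (2 * k) ^ N * alpha)
        / (1 - exp (- (2 * k) ^ N * alpha))))
  =
  ((RtoC (/ (- Rpower beta (INR (2 * N) / INR (N + 1))) ^ m
          * 2 ^ (2 * m * (N - 1)) / INR N) *
    (RtoC ((/ 2 ^ (2 * m) - 1) / 2 * zeta_nat (2 * m + 1)) +
     RtoC ((-1) ^ ((N + 3) / 2)) *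
     sum_n (fun i =>
        let j : Z := (Z.of_nat i - Z.of_nat ((N - 1) / 2))%Z in
        RtoC (powerRZ (-1) j) *
        CSeries (fun n =>
          let k := INR (S n) in
          RtoC ((-1) ^ (S n) / k ^ (2 * m + 1)) /
          (Cexp (RtoC (Rpower (2 * k) (/ INR N) * beta) *
                 Cexp (0%R, (PI * IZR j / INR N)%R)) - 1)))%C
       (N - 1)))
  +
  RtoC ((-1) ^ (m + (N + 3) / 2) * 2 ^ (2 * N * m) *
    sum_f_R0 (fun j =>
      let d : Z := (Z.of_nat m - Z.of_nat j)%Z in
      let idx : nat := Z.to_nat (Z.of_nat (N + 1) + 2 * Z.of_nat N * d)%Z in
      (-1) ^ j * (powerRZ 2 (1 - 2 * Z.of_nat j) - 1)
        * bernoulli (2 * j) * bernoulli idx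
        / (INR (fact (2 * j)) * INR (fact idx))
        * Rpower alpha (INR (2 * j) / INR (N + 1))
        * Rpower beta (INR N + 2 * INR N ^ 2 * IZR d / INR (N + 1)))%R
     ((N + 1 + 2 * N * m) / (2 * N))))%C.
Proof.
  destruct HNodd as [h ->].
  replace ((2 * h + 1 - 1) / 2)%nat with h by (apply Nat.div_unique with 0%nat; lia).
  replace ((2 * h + 1 + 3) / 2)%nat with (h + 2)%nat by (apply Nat.div_unique with 0%nat; lia).
  rewrite (inv_sinh_series (2 * h + 1) m alpha beta) by (auto; lia).
  rewrite sum_n_Csum. replace (S (2 * h + 1 - 1)) with (2 * h + 1)%nat by lia.
  cbv zeta.
  change (fun i : nat => (RtoC (powerRZ (-1) (Z.of_nat i - Z.of_nat h)) *
        CSeries (fun n =>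
          RtoC ((-1) ^ (S n) / INR (S n) ^ (2 * m + 1)) /
          (Cexp (RtoC (Rpower (2 * INR (S n)) (/ INR (2 * h + 1)) * beta) *
                 Cexp (0%R, (PI * IZR (Z.of_nat i - Z.of_nat h) / INR (2 * h + 1))%R)) - 1)))%C)
    with (fun i : nat => (RtoC (powerRZ (-1) (Z.of_nat i - Z.of_nat h)) * CSeries (rhs_inner h m beta i))%C).
  rewrite rhs_sum by auto.
  (* Everything is real from here on. The [zeta (2 m + 1)] inside [rhs_sum] cancels the explicit
     one, since [(N + 3) / 2 = h + 2] makes the two signs multiply to [1]. *)
  rewrite <- RtoC_mult, <- RtoC_plus, <- RtoC_mult, <- RtoC_plus. f_equal.
  assert (X := Rpower_alpha_prefactor (2 * h + 1) m alpha beta ltac:(lia) Halpha Hbeta Hab).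
  assert (Ht := scale_pos (2 * h + 1) beta Hbeta).
  destruct m as [|m]; [lia|].
  assert (Y := sum_bernoulli_summands h m alpha beta Halpha Hbeta Hab).
  unfold bernoulli_summand in Y. cbv zeta in Y. rewrite Y. clear Y.
  replace (/ (- Rpower beta (INR (2 * (2 * h + 1)) / INR (2 * h + 1 + 1))) ^ S m * 2 ^ (2 * S m * (2 * h + 1 - 1)))
    with ((-1) ^ S m * prefactor (2 * h + 1) (S m) beta).
  2:{ unfold prefactor. set (u := Rpower beta _).
      replace (- u) with (-1 * u) by ring. rewrite Rpow_mult_distr, Rinv_mult.
      rewrite <- (pow_inv (-1)). replace (/ -1) with (-1) by (field; lra). ring. }
  rewrite <- X. clear X. rewrite (pow_add _ h 2). replace ((-1) ^ 2) with 1 by ring.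
  set (delta := if (h =? 0)%nat then _ else 0).
  (* [delta] vanishes unless [N = 1], where [(-1)^h] and [N] are both [1]. The factor [N] gained
     this way cancels the [1 / N] of the theorem. *)
  assert (D : (-1) ^ h * delta = INR (2 * h + 1) * delta).
  { unfold delta. destruct (Nat.eqb_spec h 0) as [->|_]; simpl; ring. }
  assert (EH := pow_m1_sqr h). assert (HP := PI_RGT_0). assert (HN := INR_odd_pos h).
  replace (2 * S (S m))%nat with (2 * S m + 2)%nat by lia.
  rewrite (pow_add (scale _ _) (2 * S m) 2).
  assert (HT : 0 < scale (2 * h + 1) beta ^ (2 * S m)) by now apply pow_lt.
  revert D EH HN Ht HT.
  (* With powers, series and zeta values turned into variables, a rational identity remains, which
     [field] decides once [D] and [EH] have removed the sign. *)
  generalize (scale (2 * h + 1) beta ^ (2 * S m)) as T.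
  generalize (lattice_sum (scale (2 * h + 1) beta) (2 * h + 1) 0 (S m)) as G0.
  generalize (lattice_sum (scale (2 * h + 1) beta) (2 * h + 1) (S m) 0) as G.
  generalize (scale (2 * h + 1) beta) as tau, (INR (2 * h + 1)) as n, ((-1) ^ h) as e, ((-1) ^ S m) as s,
    (/ 2 ^ (2 * S m)) as f, (Rpower alpha (- INR (2 * (2 * h + 1) * S m) / INR (2 * h + 1 + 1))) as A,
    (zeta_nat (2 * S m + 1)) as z, (zeta_nat (2 * (2 * h + 1) * S m + 1 + (2 * h + 1))) as z1, delta as dl.
  intros tau n e s f A z z1 dl G G0 T D EH HN Ht HT.
  replace (e * 1 * (dl + e * (n / PI * G0 - / 2 * (f - 1) * z)))
    with (n * dl + (n / PI * G0 - / 2 * (f - 1) * z)).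
  - field. lra.
  - transitivity (e * dl + e * e * (n / PI * G0 - / 2 * (f - 1) * z)). rewrite D, EH; ring. ring.
Qed.
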